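(* Let $A$ be a nonnegative selfadjoint linear relation in a complex Hilbert space $\mathcal H$, let $\mathcal L$ be a closed subspace of $\mathcal H$, and let $P_{\mathcal L}$ be the orthogonal projection onto $\mathcal L$. Then $$A_{\mathcal L}=\operatorname{s-R-}\lim_{t\uparrow+\infty}(A:tP_{\mathcal L}).$$
   Context: A linear relation (l.r.) in $\mathcal H$ is a closed linear subspace $A=\{\{f,f'\}\}$ of $\mathcal H\oplus\mathcal H$ (bounded operators are identified with their graphs); $\operatorname{ran}A$ is the set of second components; $\operatorname{mul}A=\{f':\{0,f'\}\in A\}$; $A^{-1}=\{\{f',f\}:\{f,f'\}\in A\}$. $A$ is selfadjoint if $A=A^*:=\{\{g,g'\}:(f',g)=(f,g')\ \forall\{f,f'\}\in A\}$, nonnegative if $(f',f)\ge0$ for all $\{f,f'\}\in A$. A nonnegative selfadjoint l.r. decomposes as $A=\mathrm{Graph}(A_o)\oplus(\{0\}\oplus\operatorname{mul}A)$ with $A_o$ a nonnegative selfadjoint operator in $\mathcal H\ominus\operatorname{mul}A$. The closed form of $A$ is $A[\varphi]=\|A_o^{1/2}\varphi\|^2$, $\varphi\in\mathcal D[A]=\operatorname{dom}A_o^{1/2}$; this gives a bijection between nonnegative selfadjoint l.r. and closed nonnegative (not necessarily densely defined) forms. The order $A_1\ge A_2$ means $\mathcal D[A_1]\subseteq\mathcal D[A_2]$ and $A_1[\varphi]\ge A_2[\varphi]$ for all $\varphi\in\mathcal D[A_1]$. The form sum $A\dot+B$ is the nonnegative selfadjoint l.r. associated with the closed form $A[\varphi]+B[\varphi]$,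 $\varphi\in\mathcal D[A]\cap\mathcal D[B]$. The parallel sum is $A:B:=(A^{-1}\dot+B^{-1})^{-1}$. $A_{\mathcal L}$ denotes the (existing, unique) maximal element of the set of nonnegative selfadjoint l.r. $\widetilde A$ in $\mathcal H$ with $\widetilde A\le A$ and $\operatorname{ran}\widetilde A\subseteq\mathcal L$. $\operatorname{s-R-}\lim A(t)=A_0$ means $(A(t)+I)^{-1}\to(A_0+I)^{-1}$ strongly. *)

(* Defs.v *)
From HB Require Import structures.
From mathcomp Require Import all_boot all_order all_algebra.
From mathcomp Require Import sesquilinear complex.
From mathcomp Require Import all_classical all_reals all_analysis.

Set Implicit Arguments.
Unset Strict Implicit.
Unset Printing Implicit Defensive.

Import Order.TTheory GRing.Theory Num.Theory.
Import numFieldNormedType.Exports.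

Local Open Scope classical_set_scope.
Local Open Scope ring_scope.

(* Linear relations in H are subsets of H * H.  Domain, range and inverse of  *)
(* a relation A are the library's A.`1, A.`2 and A^-1%relation; relations are *)
(* composed with (S \; T)%relation.  Objects that are unique when they exist  *)
(* are selected with the total choice operator get.                           *)

Section LinearRelations.
Variables (R : realType) (H : completeNormedModType R[i]).
Variable dot : {dot H for @Num.conj R[i]}.

Implicit Types (A B S T : set (H * H)) (K L : set H) (x h : H).

Definition closed_subspace (V : normedModType R[i]) (L : set V) : Prop :=
  [/\ L 0, forall (a : R[i]) (u v : V), L u -> L v -> L (a *: u + v)
    & closed L].

Definition orthogonal_complement K : set H :=
  [set x | forall k, K k -> dot x k = 0].

Definition relation_apply T x : H := get [set y | T (x, y)].

Definition mul_part A : set H := [set y | A (0, y)].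

Definition adjoint A : set (H * H) :=
  [set g : H * H | forall f, A f -> dot f.2 g.1 = dot f.1 g.2].

(* Nonnegative selfadjoint linear relations in the closed subspace K, viewed  *)
(* as a Hilbert space: the adjoint is taken in K * K.                         *)
Definition nonneg_selfadjoint_in K A : Prop :=
  [/\ closed_subspace A,
      A = adjoint A `&` (K `*` K)
    & forall f, A f -> 0 <= dot f.2 f.1].

Definition nonneg_selfadjoint A : Prop := nonneg_selfadjoint_in setT A.

Definition mul_complement A : set H := orthogonal_complement (mul_part A).

Definition operator_part A : set (H * H) :=
  A `&` (mul_complement A `*` mul_complement A).

Definition is_operator T : Prop := mul_part T `<=` [set 0].

Definition sqrt_operator K T : set (H * H) :=
  get [set S | [/\ nonneg_selfadjoint_in K S, is_operator S
                 & (S \; S)%relation = T]].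

Definition form_root A : set (H * H) :=
  sqrt_operator (mul_complement A) (operator_part A).

Definition form_dom A : set H := (form_root A).`1.

(* The norm of H takes its values in R[i]; a square of a norm is a real       *)
(* nonnegative complex number, and <= on R[i] compares such numbers as reals. *)
Definition form A x : R[i] := `|relation_apply (form_root A) x| ^+ 2.

Definition relation_le A B : Prop :=
  form_dom B `<=` form_dom A /\ forall x, form_dom B x -> form A x <= form B x.

Definition form_sum A B : set (H * H) :=
  get [set T | [/\ nonneg_selfadjoint T,
                   form_dom T = form_dom A `&` form_dom B
                 & forall x, form_dom T x -> form T x = form A x + form B x]].

Definition parallel_sum A B : set (H * H) :=
  ((form_sum A^-1 B^-1)^-1)%relation.

Definition orthogonal_projection L x : H :=
  get [set y | L y /\ orthogonal_complement L (x - y)].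

(* The graph of t P_L.                                                        *)
Definition scaled_projection (t : R) L : set (H * H) :=
  [set f : H * H | f.2 = (t%:C)%C *: orthogonal_projection L f.1].

Definition minorants_with_range A L : set (set (H * H)) :=
  [set B | [/\ nonneg_selfadjoint B, relation_le B A & B.`2 `<=` L]].

Definition shorted A L : set (H * H) :=
  get [set B | minorants_with_range A L B /\
               forall T, minorants_with_range A L T -> relation_le T B].

Definition add_identity A : set (H * H) :=
  [set (f.1, f.2 + f.1) | f in A].

Definition resolvent A h : H :=
  relation_apply ((add_identity A)^-1)%relation h.

Definition strong_resolvent_limit (A : R -> set (H * H)) (F : set_system R)
    (A0 : set (H * H)) : Prop :=
  forall h, resolvent (A t) h @[t --> F] --> resolvent A0 h.

End LinearRelations.

(* Main.v *)
(** The closed form of a nonnegative selfadjoint relation [A] is recovered from [A]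
    itself by [A[x] = sup {2 Re (f', x) - (f', f) | (f, f') in A}], and the forms of
    [A] and [A^-1] are conjugate, so inversion reverses the order.  Relations below
    [A] with range in [L] are therefore the inverses of the relations above [A^-1]
    whose form domain lies in [L], and [shorted A L] is [T^-1], where [T] is the
    relation of the form of [A^-1] restricted to [L].  Since [(t P_L)^-1] has the form
    [|x|^2 / t] on [L], the parallel sum of [A] and [t P_L] is [(T + 1/t)^-1], and
    monotonicity of [T] bounds the distance of the two resolvents at [h] by [|h| / t].

    Relations of closed forms come from von Neumann's theorem ([S^* S] is selfadjoint
    for every closed relation [S]).  Square roots of unbounded relations come from
    those of contractions: if [B = (A + 1)^-1], then [{(B^(1/2) h, (1 - B)^(1/2) h)}]
    is the square root of [A]. *)

Require Import Defs.
From HB Require Import structures.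
From mathcomp Require Import all_boot all_order all_algebra.
From mathcomp Require Import sesquilinear complex.
From mathcomp Require Import all_classical all_reals all_analysis.
From mathcomp Require Import ring lra.

Set Implicit Arguments.
Unset Strict Implicit.
Unset Printing Implicit Defensive.

Import Order.TTheory GRing.Theory Num.Theory.
Import numFieldNormedType.Exports.

Local Open Scope classical_set_scope.
Local Open Scope ring_scope.

(** * Real inner product and squared norm *)

Section HilbertSpace.
Variables (R : realType) (H : completeNormedModType R[i]).
Variable dot : {dot H for @Num.conj R[i]}.
Hypothesis norm_dot : forall x : H, `|x| ^+ 2 = dot x x.

(** Estimates are carried out over the reals, where [lra] applies; [dot_im] recovers the imaginary
    part of [dot] by passing from x to i x. *)
Definition rdot (x y : H) : R := complex.Re (dot x y).
Definition sqn (x : H) : R := rdot x x.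

Lemma rdotC x y : rdot x y = rdot y x.
Proof.
have e : dot x y = Num.conj (dot y x) by rewrite [LHS](hermC dot) expr0 mul1r.
by rewrite /rdot e; case: (dot y x).
Qed.


Lemma rdotDl x y z : rdot (x + y) z = rdot x z + rdot y z.
Proof.
rewrite /rdot linearDl.
by apply: (raddfD (@complex.Re R : Rcomplex R -> R)).
Qed.

Lemma rdotNl x z : rdot (- x) z = - rdot x z.
Proof. rewrite -[LHS](addrK (rdot x z)) -rdotDl addNr.
by rewrite /rdot linear0l /= sub0r.
Qed.

Lemma rdotZl (a : R) x z : rdot (a%:C%C *: x) z = a * rdot x z.
Proof.
have e : dot (a%:C%C *: x) z = a%:C%C * dot x z by rewrite linearZl_LR.
by rewrite /rdot e; case: (dot x z) => u v /=; ring.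
Qed.

Lemma rdotDr x y z : rdot z (x + y) = rdot z x + rdot z y.
Proof. by rewrite ![rdot z _]rdotC rdotDl. Qed.

Lemma rdotNr x z : rdot z (- x) = - rdot z x.
Proof. by rewrite ![rdot z _]rdotC rdotNl. Qed.

Lemma rdotZr (a : R) x z : rdot z (a%:C%C *: x) = a * rdot z x.
Proof. by rewrite ![rdot z _]rdotC rdotZl. Qed.

Lemma rdot0l z : rdot 0 z = 0.
Proof. by rewrite /rdot linear0l. Qed.

Lemma rdot0r z : rdot z 0 = 0. Proof. by rewrite rdotC rdot0l. Qed.

Definition rdotE := (rdotDl, rdotDr, rdotNl, rdotNr, rdotZl, rdotZr, rdot0l, rdot0r).

Lemma normE (x : H) : `|x| = (complex.Re `|x|)%:C%C.
Proof.
have := normr_ge0 x; case: (`|x|) => a b; rewrite lecE /= => /andP[/eqP -> _].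
by [].
Qed.

Lemma Re_norm_ge0 (x : H) : 0 <= complex.Re `|x|.
Proof. by have := normr_ge0 x; rewrite lecE => /andP[]. Qed.

Lemma dot_self x : dot x x = (sqn x)%:C%C.
Proof.
by rewrite /sqn /rdot -norm_dot normE -rmorphXn /=.
Qed.

Lemma sqn_norm (x : H) : sqn x = complex.Re `|x| ^+ 2.
Proof. by rewrite /sqn /rdot -norm_dot normE -rmorphXn. Qed.

Lemma sqn_ge0 x : 0 <= sqn x.
Proof. by rewrite sqn_norm sqr_ge0. Qed.

Lemma sqn_eq0 x : sqn x = 0 -> x = 0.
Proof.
rewrite sqn_norm => /eqP; rewrite sqrf_eq0 => /eqP h.
by apply/eqP; rewrite -normr_eq0 normE h.
Qed.

Lemma sqn_le0 x : sqn x <= 0 -> x = 0.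
Proof. by move=> h; apply: sqn_eq0; apply/eqP; rewrite eq_le h sqn_ge0. Qed.

Lemma sqnD x y : sqn (x + y) = sqn x + 2 * rdot x y + sqn y.
Proof. by rewrite /sqn !rdotE (rdotC y x); ring. Qed.

Lemma sqnB x y : sqn (x - y) = sqn x - 2 * rdot x y + sqn y.
Proof. by rewrite /sqn !rdotE (rdotC y x); ring. Qed.

Lemma sqnZ (a : R) x : sqn (a%:C%C *: x) = a ^+ 2 * sqn x.
Proof. by rewrite /sqn !rdotE; ring. Qed.

Lemma sqnN x : sqn (- x) = sqn x.
Proof. by rewrite /sqn !rdotE opprK. Qed.

Lemma sqn0 : sqn 0 = 0. Proof. exact: rdot0l. Qed.

Lemma rdot_sqr_le x y : rdot x y ^+ 2 <= sqn x * sqn y.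
Proof.
have [y0|y0] := eqVneq (sqn y) 0.
  by rewrite (sqn_eq0 y0) rdot0r sqn0 mulr0 expr0n.
have y1 : 0 < sqn y by rewrite lt_def y0 sqn_ge0.
have := sqn_ge0 (x - (rdot x y / sqn y)%:C%C *: y).
rewrite sqnB sqnZ rdotE -(pmulr_lge0 _ y1) => h.
rewrite -subr_ge0; congr (0 <= _): h.
by field.
Qed.

Lemma dot_im x y : complex.Im (dot x y) = - rdot ('i%C *: x) y.
Proof.
have e : dot ('i%C *: x) y = 'i%C * dot x y by rewrite linearZl_LR.
by rewrite /rdot e; case: (dot x y) => a b /=; ring.
Qed.

(** The norm takes its values in [R[i]]; limits are moved to real squared norms so that squeezing
    and real arithmetic apply. *)
Lemma cvg_sqn (T : Type) (F : set_system T) (FF : Filter F) (f : T -> H) l :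
  (f @ F --> l) <-> ((fun t => sqn (f t - l)) @ F --> (0 : R)).
Proof.
split=> h.
- apply/cvgr0Pnorm_lt => e e0.
  have e1 : (0 : R[i]) < (Num.sqrt e)%:C%C by rewrite ltcR sqrtr_gt0.
  move/cvgrPdist_lt: h => /(_ _ e1); apply: filterS => t.
  rewrite distrC normE ltcR => h; rewrite ger0_norm ?sqn_ge0 // sqn_norm.
  by rewrite -[ltRHS]sqr_sqrtr ?(ltW e0)// ltr_pXn2r // nnegrE ?sqrtr_ge0 ?Re_norm_ge0.
- apply/cvgrPdist_lt => e; case: e => a b; rewrite ltcE /= => /andP[/eqP -> a0].
  move/cvgr0Pnorm_lt: h => /(_ (a ^+ 2)); rewrite exprn_gt0 // => /(_ isT).
  apply: filterS => t; rewrite ger0_norm ?sqn_ge0 // sqn_norm => h.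
  rewrite distrC normE ltcR.
  by move: h; rewrite ltr_pXn2r // nnegrE ?Re_norm_ge0 ?ltW.
Qed.

Lemma parallelogram x y : sqn (x + y) + sqn (x - y) = 2 * sqn x + 2 * sqn y.
Proof. by rewrite sqnD sqnB; ring. Qed.

Lemma sqnD_le x y : sqn (x + y) <= 2 * sqn x + 2 * sqn y.
Proof. by have := sqn_ge0 (x - y); have := parallelogram x y; lra. Qed.

Lemma norm_rdot_le x y : `|rdot x y| <= Num.sqrt (sqn x) * Num.sqrt (sqn y).
Proof.
rewrite -sqrtrM ?sqn_ge0 // -[leLHS]sqrtr_sqr.
by rewrite ler_wsqrtr // rdot_sqr_le.
Qed.

Lemma cvg_rdot (T : Type) (F : set_system T) (FF : Filter F) (f g : T -> H) x y :
  f @ F --> x -> g @ F --> y -> (fun t => rdot (f t) (g t)) @ F --> rdot x y.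
Proof.
move=> /cvg_sqn hf /cvg_sqn hg.
have sq0 (h : T -> H) z : (fun t => sqn (h t - z)) @ F --> (0 : R) ->
    (fun t => Num.sqrt (sqn (h t - z))) @ F --> (0 : R).
  move=> hh; rewrite -[X in _ --> X](@sqrtr0 R).
  by apply: continuous_cvg hh; exact: sqrt_continuous.
have {hf} hf := sq0 _ _ hf; have {hg} hg := sq0 _ _ hg.
pose b t := Num.sqrt (sqn (f t - x)) * Num.sqrt (sqn (g t - y)) +
  Num.sqrt (sqn (f t - x)) * Num.sqrt (sqn y) +
  Num.sqrt (sqn x) * Num.sqrt (sqn (g t - y)).
have hb : b @ F --> (0 : R).
  rewrite (_ : 0 = 0 * 0 + 0 * Num.sqrt (sqn y) + Num.sqrt (sqn x) * 0); last by ring.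
  by apply: cvgD; [apply: cvgD|]; apply: cvgM => //; exact: cvg_cst.
apply/subr_cvg0; apply/norm_cvg0P.
apply: (@squeeze_cvgr _ _ _ _ (cst 0) b) => //; last exact: cvg_cst.
near=> t; rewrite /cst normr_ge0 /=.
rewrite (_ : _ - _ = rdot (f t - x) (g t - y) + rdot (f t - x) y + rdot x (g t - y)); last first.
  by rewrite !rdotE; ring.
rewrite (le_trans (ler_normD _ _))// lerD ?norm_rdot_le//.
by rewrite (le_trans (ler_normD _ _))// lerD ?norm_rdot_le//.
Unshelve. all: end_near. Qed.

Lemma sqn_cauchy_cvg (u : nat -> H) :
  (forall e, 0 < e -> exists N, forall m n, (N <= m)%N -> (N <= n)%N ->
     sqn (u m - u n) < e) -> exists l : H, u @ \oo --> l.
Proof.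
move=> h; suff /cauchy_cvgP/cvg_ex : cauchy (u @ \oo) by [].
apply/cauchyP => e; case: e => a b; rewrite ltcE /= => /andP[/eqP -> a0].
have /h[N hN] : 0 < a ^+ 2 by rewrite exprn_gt0.
exists (u N); exists N => // n /= Nn.
rewrite -ball_normE /= normE ltcR.
by have := hN N n (leqnn _) Nn; rewrite sqn_norm ltr_pXn2r // nnegrE ?Re_norm_ge0 ?ltW.
Qed.

(** * Orthogonal projection and closed subspaces *)

Definition pair_dot (p q : H * H) : R := rdot p.1 q.1 + rdot p.2 q.2.

(** First-order condition at a minimum. At s = r / (Q + 1) the quadratic equals - r^2 (Q + 2) / (Q +
    1)^2; the added 1 keeps the denominator positive when Q = 0. *)
Lemma quadratic_ge0 (Q r : R) : 0 <= Q ->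
  (forall s, 0 <= s ^+ 2 * Q - 2 * s * r) -> r = 0.
Proof.
move=> Q0 /(_ (r / (Q + 1))) h.
have Q1 : 0 < Q + 1 by lra.
have {}h : 0 <= ((r / (Q + 1)) ^+ 2 * Q - 2 * (r / (Q + 1)) * r) * (Q + 1) ^+ 2.
  by rewrite mulr_ge0 // exprn_ge0 // ltW.
have e : ((r / (Q + 1)) ^+ 2 * Q - 2 * (r / (Q + 1)) * r) * (Q + 1) ^+ 2 =
   - (r ^+ 2 * (Q + 2)) by field; rewrite gt_eqF.
rewrite e in h; apply/eqP; rewrite -sqrf_eq0 eq_le sqr_ge0 andbT.
have Q2 : 0 < Q + 2 by lra.
by rewrite -(pmulr_lle0 _ Q2); lra.
Qed.

Lemma harmonic_small (e : R) : 0 < e -> exists N, forall n, (N <= n)%N -> n.+1%:R^-1 < e.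
Proof.
move=> e0; exists (Num.truncn e^-1) => n Nn.
rewrite invf_plt ?posrE// (lt_le_trans (truncnS_gt _))//.
by rewrite ler_nat.
Qed.

Lemma subspaceZ (V : normedModType R[i]) (M : set V) : closed_subspace M ->
  forall a x, M x -> M (a *: x).
Proof. by case=> M0 ML _ a x Mx; rewrite -[_ *: _]addr0; apply: ML. Qed.

Lemma subspaceD (V : normedModType R[i]) (M : set V) : closed_subspace M ->
  forall x y, M x -> M y -> M (x + y).
Proof. by case=> M0 ML _ x y Mx My; rewrite -[x]scale1r; apply: ML. Qed.

Lemma subspaceN (V : normedModType R[i]) (M : set V) : closed_subspace M ->
  forall x, M x -> M (- x).
Proof. by move=> cM x Mx; rewrite -scaleN1r; apply: subspaceZ. Qed.

Lemma subspaceB (V : normedModType R[i]) (M : set V) : closed_subspace M ->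
  forall x y, M x -> M y -> M (x - y).
Proof. by move=> cM x y Mx My; apply: subspaceD => //; exact: subspaceN. Qed.

(* Closedness is only required for sequences, so that the lemma also applies to the
   range of [1 + A], where it is easier to check than for arbitrary filters. *)
Lemma projection_pair (M : set (H * H)) (a : H * H) :
  M 0 -> (forall k u v, M u -> M v -> M (k *: u + v)) ->
  (forall (u : nat -> H * H) (x y : H), (forall n, M (u n)) ->
     (fun n => (u n).1) @ \oo --> x -> (fun n => (u n).2) @ \oo --> y -> M (x, y)) ->
  exists2 p, M p & forall q, M q -> pair_dot (a - p) q = 0.
Proof.
move=> M0 ML clM.
have MD u v : M u -> M v -> M (u + v) by move=> Mu Mv; rewrite -[u]scale1r; apply: ML.
have MZ k u : M u -> M (k *: u) by move=> Mu; rewrite -[_ *: _]addr0; apply: ML.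
pose N (p : H * H) := pair_dot p p.
have N_ge0 p : 0 <= N p by rewrite addr_ge0 // sqn_ge0.
have Npar p q : N (p + q) + N (p - q) = 2 * N p + 2 * N q.
  have := parallelogram p.1 q.1; have := parallelogram p.2 q.2.
  by rewrite /N /pair_dot -!/(sqn _) /=; lra.
have Nhalf p : N ((2^-1)%:C%C *: p) = 4^-1 * N p.
  by rewrite /N /pair_dot -!/(sqn _) /= !sqnZ; field.
pose E := [set N (a - p) | p in M].
have lbE : lbound E 0 by move=> _ [p _ <-].
have hE : has_inf E by split; [exists (N (a - 0)), 0 | exists 0].
pose d := inf E.
have dle p : M p -> d <= N (a - p) by move=> Mp; apply: ge_inf; [exists 0|exists p].
have ex n : exists p, M p /\ N (a - p) < d + n.+1%:R^-1.
  have [|_ [p Mp <-] h] := @inf_adherent _ E n.+1%:R^-1 _ hE; last by exists p.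
  by rewrite invr_gt0.
have [p hp] := choice ex.
(* The midpoint of [p m] and [p n] lies in [M], so its squared distance to [a] is at least [d]; the
   parallelogram law turns this into a bound on the gap. *)
have close m n : N (p m - p n) <= 2 * m.+1%:R^-1 + 2 * n.+1%:R^-1.
  have [Mm hm] := hp m; have [Mn hn] := hp n.
  have := dle ((2^-1)%:C%C *: (p m + p n)) (MZ _ _ (MD _ _ Mm Mn)).
  have -> : a - (2^-1)%:C%C *: (p m + p n) = (2^-1)%:C%C *: ((a - p m) + (a - p n)).
    rewrite addrACA -opprD scalerBr; congr (_ - _).
    have e : (2^-1)%:C%C + (2^-1)%:C%C = 1 :> R[i].
      by rewrite -rmorphD (_ : 2^-1 + 2^-1 = 1) ?rmorph1 //; field.
    by rewrite scalerDr -scalerDl e scale1r.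
  rewrite Nhalf => h.
  have := Npar (a - p m) (a - p n).
  have -> : a - p m - (a - p n) = - (p m - p n).
    by rewrite opprB [RHS]opprB addrC addrA subrK.
  have -> : N (- (p m - p n)) = N (p m - p n).
    by rewrite /N /pair_dot -!/(sqn _) /= !sqnN.
  move: h hm hn; move: (N (a - p m)) (N (a - p n)) (N (p m - p n)) (N _).
  by move: (m.+1%:R^-1) (n.+1%:R^-1) => *; lra.
have cau (i : H * H -> H) : (forall q q', i (q - q') = i q - i q') ->
    (forall q, sqn (i q) <= N q) -> exists l : H, (i \o p) @ \oo --> l.
  move=> iB iN; apply: sqn_cauchy_cvg => e e0.
  have [|K hK] := @harmonic_small (e / 4); first by rewrite divr_gt0.
  exists K => m n Km Kn /=; rewrite -iB (le_lt_trans (iN _))//.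
  move: (close m n) (hK _ Km) (hK _ Kn).
  by move: (N (p m - p n)) (m.+1%:R^-1) (n.+1%:R^-1) => *; lra.
have [||l1 hl1] := cau fst => //.
  by move=> q; rewrite /N /pair_dot -!/(sqn _) lerDl sqn_ge0.
have [||l2 hl2] := cau snd => //.
  by move=> q; rewrite /N /pair_dot -!/(sqn _) lerDr sqn_ge0.
pose l := (l1, l2).
have Ml : M l by apply: (clM p) => // n; case: (hp n).
have Nl : N (a - l) <= d.
  have c1 : (fun n => N (a - p n)) @ \oo --> N (a - l).
    by apply: cvgD; apply: cvg_rdot; apply: cvgB => //; exact: cvg_cst.
  have c2 : (fun n => d + n.+1%:R^-1) @ \oo --> d.
    rewrite -[X in _ --> X]addr0; apply: cvgD; first exact: cvg_cst.
    exact: cvg_harmonic.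
  apply: ler_cvg_to c1 c2 _; apply: nearW => n; exact: ltW (hp n).2.
exists l => // q Mq.
(* Moving [l] by a multiple of [q] stays in [M] and cannot decrease the distance to [a]. *)
apply: (@quadratic_ge0 (N q)) => // s.
have := dle _ (MD _ _ Ml (MZ s%:C%C _ Mq)).
rewrite /N /pair_dot -!/(sqn _) /= !opprD !addrA ![sqn (_ - _ - _)]sqnB !sqnZ !rdotE.
by move: Nl; rewrite /N /pair_dot -!/(sqn _) /= ![sqn (_ - _)]sqnB; lra.
Qed.

Lemma cvg_cauchy_sqn (u : nat -> H) (l : H) : u @ \oo --> l ->
  forall e, 0 < e -> exists N, forall m n, (N <= m)%N -> (N <= n)%N -> sqn (u m - u n) < e.
Proof.
move=> /cvg_sqn /cvgr0Pnorm_lt h e e0.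
have /h[N _ hN] : 0 < e / 4 by lra.
exists N => m n Nm Nn.
have := sqnD_le (u m - l) (- (u n - l)).
rewrite sqnN opprB addrA subrK.
by move: (hN _ Nm) (hN _ Nn); rewrite /= !ger0_norm ?sqn_ge0 //; lra.
Qed.

Lemma rdot_i x y : rdot ('i%C *: x) y = - rdot x ('i%C *: y).
Proof.
have e : dot x y = Num.conj (dot y x) by rewrite [LHS](hermC dot) expr0 mul1r.
have : complex.Im (dot x y) = - complex.Im (dot y x) by rewrite e; case: (dot y x).
by rewrite !dot_im (rdotC x) => h; lra.
Qed.

Lemma closed_seq (M : set (H * H)) : closed M ->
  forall (u : nat -> H * H) (x y : H), (forall n, M (u n)) ->
     (fun n => (u n).1) @ \oo --> x -> (fun n => (u n).2) @ \oo --> y -> M (x, y).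
Proof.
move=> clM u x y Mu ux uy.
apply: (closed_cvg M clM (u_ := u) (F := \oo)); first exact: nearW.
rewrite (_ : u = fun n => ((u n).1, (u n).2)); last by apply/funext => n; case: (u n).
exact: cvg_pair.
Qed.

Lemma closed_seq1 (M : set H) : closed M ->
  forall (u : nat -> H) (x : H), (forall n, M (u n)) -> u @ \oo --> x -> M x.
Proof.
move=> clM u x Mu ux.
by apply: (closed_cvg M clM (u_ := u) (F := \oo)) => //; exact: nearW.
Qed.

(** Serves the uniqueness arguments: if two pairs have equal sums of components, their differences
    are opposite, and monotonicity forces both to vanish. *)
Lemma sum_eq_sub (V : zmodType) (x y u v : V) : x + y = u + v -> y - v = - (x - u).
Proof.
by move=> e; apply/eqP; rewrite opprB subr_eq addrAC -e addrAC subrr add0r.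
Qed.

Implicit Types (A B M : set (H * H)).

(** * Nonnegative selfadjoint relations *)

Lemma adjoint_rdot A g : adjoint dot A g ->
  forall f, A f -> rdot f.2 g.1 = rdot f.1 g.2.
Proof. by move=> h f Af; rewrite /rdot (h _ Af). Qed.

(** The imaginary part of the identity at f is, up to sign, its real part at i f, which [A] also
    contains. *)
Lemma rdot_adjoint A g : (forall a f, A f -> A (a *: f)) ->
  (forall f, A f -> rdot f.2 g.1 = rdot f.1 g.2) -> adjoint dot A g.
Proof.
move=> AZ h f Af; apply/eqP; rewrite eq_complex; apply/andP; split; apply/eqP.
  exact: h.
by rewrite !dot_im (h _ (AZ 'i%C _ Af)).
Qed.

Lemma adjoint_closed_subspace A : (forall a f, A f -> A (a *: f)) ->
  closed_subspace (adjoint dot A).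
Proof.
move=> AZ; split.
- by apply: rdot_adjoint => // f Af; rewrite !rdotE.
- move=> a u v hu hv f Af /=.
  have hZ (x y : H) : dot x (a *: y) = Num.conj a * dot x y by rewrite linearZr_LR.
  have hD (x y z : H) : dot x (y + z) = dot x y + dot x z by rewrite linearDr.
  by rewrite !hD !hZ hu // hv.
(* An adjoint is an intersection of zero sets of continuous real functions, one for each pair of
   [A]. *)
- rewrite (_ : adjoint dot A = \bigcap_(f in A)
      (fun g : H * H => rdot f.2 g.1 - rdot f.1 g.2) @^-1` [set 0]); last first.
    apply/seteqP; split => g.
      by move=> h f Af; rewrite /preimage /= (adjoint_rdot h) // subrr.
    move=> h; apply: rdot_adjoint => // f Af.
    by apply/eqP; rewrite -subr_eq0; apply/eqP; exact: (h f Af).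
  apply: closed_bigI => f Af.
  apply: closed_comp; last exact: closed_eq.
  move=> p _; apply: cvgB; apply: cvg_rdot; try exact: cvg_cst.
    exact: cvg_fst.
  exact: cvg_snd.
Qed.

Lemma nsa_subspace A : nonneg_selfadjoint dot A -> closed_subspace A.
Proof. by case. Qed.

Lemma nsa_sym A : nonneg_selfadjoint dot A ->
  forall f g, A f -> A g -> rdot f.2 g.1 = rdot f.1 g.2.
Proof. by case=> _ e _ f g Af; rewrite e => -[/adjoint_rdot h _]; exact: h. Qed.

Lemma nsa_ge0 A : nonneg_selfadjoint dot A -> forall f, A f -> 0 <= rdot f.2 f.1.
Proof. by case=> _ _ h f /h; rewrite lecE => /andP[]. Qed.

Lemma nsa_max A : nonneg_selfadjoint dot A ->
  forall g, (forall f, A f -> rdot f.2 g.1 = rdot f.1 g.2) -> A g.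
Proof.
move=> hA g hg; have [cA e _] := hA; rewrite e; split => //.
by apply: rdot_adjoint hg => a f; exact: subspaceZ.
Qed.

(** Symmetry applied to i f and f makes the imaginary part of (f', f) vanish. *)
Lemma dot_ge0 A f : (forall k u, A u -> A (k *: u)) ->
  (forall f g, A f -> A g -> rdot f.2 g.1 = rdot f.1 g.2) ->
  A f -> 0 <= rdot f.2 f.1 -> 0 <= dot f.2 f.1.
Proof.
move=> AZ Asym Af f0; rewrite lecE; apply/andP; split => //.
have h : rdot ('i%C *: f.2) f.1 = rdot ('i%C *: f.1) f.2 := Asym _ _ (AZ 'i%C _ Af) Af.
have h2 : rdot ('i%C *: f.2) f.1 = - rdot ('i%C *: f.1) f.2 by rewrite rdot_i rdotC.
by rewrite dot_im; apply/eqP => /=; lra.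
Qed.

(** Range criterion: when 1 + A is onto, each pair of the adjoint coincides with the pair of [A]
    that has the same sum of components. Thus [A] is its own adjoint, and closed as such. *)
Lemma nsaI A : A 0 -> (forall k u v, A u -> A v -> A (k *: u + v)) ->
  (forall f g, A f -> A g -> rdot f.2 g.1 = rdot f.1 g.2) ->
  (forall f, A f -> 0 <= rdot f.2 f.1) ->
  (forall h, exists2 f, A f & f.1 + f.2 = h) -> nonneg_selfadjoint dot A.
Proof.
move=> A0 AL Asym Age0 Asurj.
have AZ k u : A u -> A (k *: u) by move=> Au; rewrite -[_ *: _]addr0; apply: AL.
have e : A = adjoint dot A.
  apply/seteqP; split => g; first by move=> Ag; apply: rdot_adjoint => // f Af; exact: Asym.
  move=> /adjoint_rdot hg.
  (* [f] has the same sum as [g], and [k] resolves g.1 - f.1; testing [g] and [f] against [k] shows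
     that g.1 - f.1 is orthogonal to itself. *)
  have [f Af ef] := Asurj (g.1 + g.2).
  have [k Ak ek] := Asurj (g.1 - f.1).
  have e2 : g.2 - f.2 = - (g.1 - f.1) by apply: sum_eq_sub; rewrite ef.
  have : sqn (g.1 - f.1) = 0.
    rewrite /sqn -{1}ek rdotDl [rdot k.2 _]rdotDr rdotNr (hg _ Ak) (Asym _ _ Ak Af).
    rewrite -[rdot k.1 g.2 - _](_ : rdot k.1 (g.2 - f.2) = _); last by rewrite !rdotE.
    by rewrite e2 rdotNr subrr.
  move=> /sqn_eq0/eqP z0; move: e2; rewrite (eqP z0) oppr0 => /eqP.
  move: z0; rewrite !subr_eq0 => /eqP z1 /eqP z2.
  by rewrite (surjective_pairing g) z1 z2 -surjective_pairing.
split.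
- by rewrite e; exact: adjoint_closed_subspace.
- by rewrite -e; apply/seteqP; split => [f Af|f []].
- by move=> f Af; apply: (dot_ge0 AZ Asym Af); exact: Age0.
Qed.

(** Nonnegativity bounds both components of f by f.1 + l f.2, so the range of 1 + l A is closed;
    maximality of [A] leaves nothing orthogonal to it. *)
Lemma nsa_resolvent A (l : R) : nonneg_selfadjoint dot A -> 0 < l ->
  forall h, exists2 f, A f & f.1 + l%:C%C *: f.2 = h.
Proof.
move=> hA l0 h; have cA := nsa_subspace hA; have [A0 AL clA] := cA.
(* The range sits in the first coordinate, with 0 in the second, so that [projection_pair]
   applies. *)
pose M : set (H * H) := [set p | p.2 = 0 /\ exists2 f, A f & f.1 + l%:C%C *: f.2 = p.1].
have [||| [p q] [/= -> [f Af ef]] hp] := @projection_pair M (h, 0).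
- by split => //; exists 0 => //=; rewrite scaler0 addr0.
- move=> k [u1 u2] [v1 v2] [/= -> [f Af <-]] [/= -> [g Ag <-]]; split => /=.
    by rewrite scaler0 addr0.
  exists (k *: f + g); first exact: AL.
  by rewrite /= !scalerDr !scalerA [k * _]mulrC addrACA.
- move=> u x y Mu ux uy; split => /=.
    have u0 : (fun n => (u n).2) = cst 0 by apply/funext => n; case: (Mu n).
    by rewrite u0 in uy; apply: cvg_unique uy (cvg_cst _).
  have /choice[f hf] n : exists f, A f /\ f.1 + l%:C%C *: f.2 = (u n).1.
    by have [_ [f Af e]] := Mu n; exists f.
  have key m n : sqn ((f m).1 - (f n).1) <= sqn ((u m).1 - (u n).1) /\
      l ^+ 2 * sqn ((f m).2 - (f n).2) <= sqn ((u m).1 - (u n).1).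
    have [Am <-] := hf m; have [An <-] := hf n.
    have /= := nsa_ge0 hA (subspaceB cA Am An).
    rewrite opprD addrACA -scalerBr [sqn (_ + _ *: _)]sqnD sqnZ rdotZr rdotC => hp.
    have h1 := sqn_ge0 ((f m).1 - (f n).1).
    have h2 := mulr_ge0 (sqr_ge0 l) (sqn_ge0 ((f m).2 - (f n).2)).
    by have h3 := mulr_ge0 (ltW l0) hp; lra.
  have [|f1 cf1] := @sqn_cauchy_cvg (fun n => (f n).1).
    move=> e e0; have [N hN] := cvg_cauchy_sqn ux e0.
    by exists N => m n Nm Nn; apply: le_lt_trans (hN m n Nm Nn); case: (key m n).
  have [|f2 cf2] := @sqn_cauchy_cvg (fun n => (f n).2).
    move=> e e0; have l2 : 0 < l ^+ 2 by rewrite exprn_gt0.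
    have [|N hN] := cvg_cauchy_sqn ux (e := l ^+ 2 * e); first exact: mulr_gt0.
    exists N => m n Nm Nn; rewrite -(ltr_pM2l l2); apply: le_lt_trans (hN m n Nm Nn).
    by case: (key m n).
  exists (f1, f2) => /=.
    by apply: closed_seq cf1 cf2 => // n; case: (hf n).
  have c1 : (fun n => (u n).1) @ \oo --> f1 + l%:C%C *: f2.
    rewrite (_ : (fun n => (u n).1) = (fun n => (f n).1 + l%:C%C *: (f n).2)); last first.
      by apply/funext => n; case: (hf n).
    by apply: cvgD => //; apply: cvgZr.
  exact: cvg_unique c1 ux.
exists f => //; rewrite ef.
have {}hp k : A k -> rdot (h - p) (k.1 + l%:C%C *: k.2) = 0.
  move=> Ak; have := hp (k.1 + l%:C%C *: k.2, 0).
  rewrite /pair_dot /= rdot0r addr0; apply; split => //=; by exists k.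
(* The residual z = h - p is orthogonal to the range, which says that (l z, - z) is in the adjoint;
   nonnegativity then gives - l |z|^2 >= 0. *)
have Az : A (l%:C%C *: (h - p), - (h - p)).
  apply: (nsa_max hA) => k Ak; have := hp _ Ak; rewrite rdotC /= rdotDl !rdotZl rdotZr rdotNr.
  by move=> ?; lra.
have /= := nsa_ge0 hA Az; rewrite rdotNl rdotZr -/(sqn _) oppr_ge0 => hz.
have /sqn_le0/eqP : sqn (h - p) <= 0 by rewrite -(pmulr_rle0 _ l0).
by rewrite subr_eq0 => /eqP.
Qed.

Lemma nsa_resolvent_inj A f g : nonneg_selfadjoint dot A -> A f -> A g ->
  f.1 + f.2 = g.1 + g.2 -> f = g.
Proof.
move=> hA Af Ag e.
have /= := nsa_ge0 hA (subspaceB (nsa_subspace hA) Af Ag).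
have e2 : f.2 - g.2 = - (f.1 - g.1) by exact: sum_eq_sub.
rewrite e2 rdotNl oppr_ge0 => /sqn_le0/eqP z0; move: e2; rewrite (eqP z0) oppr0 => /eqP.
move: z0; rewrite !subr_eq0 => /eqP z1 /eqP z2.
by rewrite (surjective_pairing f) z1 z2 -surjective_pairing.
Qed.

Lemma nsa_subset A B : nonneg_selfadjoint dot A -> nonneg_selfadjoint dot B ->
  A `<=` B -> A = B.
Proof.
move=> hA hB AB; apply/seteqP; split => // g Bg; apply: (nsa_max hA) => f /AB Bf.
exact: nsa_sym Bf Bg.
Qed.

(** * Closed forms without square roots *)

(* When [A = S^* S], the supremum of [2 (f', x) - (f', f)] over [A] is [|S x|^2],
   because the expression equals [|S x|^2 - |S (x - f)|^2].  So [epi A x c] says that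
   [x] is in the form domain of [A] and that the form is at most [c] at [x]; unlike
   [form], it does not mention square roots. *)
Definition epi A (x : H) (c : R) : Prop :=
  forall f, A f -> 2 * rdot f.2 x - rdot f.2 f.1 <= c.

Lemma epi_graph A f : nonneg_selfadjoint dot A -> A f -> epi A f.1 (rdot f.2 f.1).
Proof.
move=> hA Af g Ag; have /= := nsa_ge0 hA (subspaceB (nsa_subspace hA) Af Ag).
have := nsa_sym hA Af Ag; rewrite !rdotE (rdotC g.2 f.1) => h.
by lra.
Qed.

(** The pair that solves the resolvent equation at [x], a Yosida approximant, is itself taken as the
    test pair in [epi]. *)
Lemma epi_approx A x c l : nonneg_selfadjoint dot A -> epi A x c -> 0 < l ->
  exists f, [/\ A f, f.1 + l%:C%C *: f.2 = x & rdot f.2 f.1 + 2 * l * sqn f.2 <= c].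
Proof.
move=> hA hx l0; have [f Af e] := nsa_resolvent hA l0 x.
exists f; split => //; have := hx _ Af; rewrite -e !rdotE -/(sqn _).
by lra.
Qed.

(** With l = 1 / (n + 1), the previous bound gives |f.1 - x|^2 = l^2 |f.2|^2 <= c l. Limits along
    these approximants carry inequalities from the domain to the form domain. *)
Lemma epi_approx_seq A x c : nonneg_selfadjoint dot A -> epi A x c ->
  exists f : nat -> H * H, [/\ forall n, A (f n),
    forall n, (f n).1 + (n.+1%:R^-1)%:C%C *: (f n).2 = x,
    forall n, rdot (f n).2 (f n).1 <= c
    & (fun n => (f n).1) @ \oo --> x].
Proof.
move=> hA hx.
have l0 n : 0 < n.+1%:R^-1 :> R by rewrite invr_gt0.
have /choice[f hf] n := epi_approx hA hx (l0 n).
have le n : 0 <= n.+1%:R^-1 * sqn (f n).2.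
  by rewrite mulr_ge0 ?sqn_ge0 // ltW.
exists f; split => [n|n|n|]; try by case: (hf n).
  have [_ _] := hf n; have := le n.
  by rewrite -mulrA; move: (n.+1%:R^-1 * _) => t; lra.
apply/cvg_sqn.
apply: (@squeeze_cvgr _ _ _ _ (cst 0) (fun n => c * n.+1%:R^-1)); first last.
- by rewrite -[X in _ --> X](mulr0 c); apply: cvgM; [exact: cvg_cst|exact: cvg_harmonic].
- exact: cvg_cst.
apply: nearW => n; rewrite /cst sqn_ge0 /=.
have [Af e h] := hf n.
have -> : (f n).1 - x = - ((n.+1%:R^-1)%:C%C *: (f n).2).
  by apply/eqP; rewrite subr_eq -e addrC addrK.
rewrite sqnN sqnZ expr2 -mulrA mulrC ler_pM2r //.
have := le n; have := nsa_ge0 hA Af.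
by move: h; rewrite -mulrA; move: (n.+1%:R^-1 * _) => t; lra.
Qed.

(** Fenchel-Young inequality for the conjugate forms of [A] and its inverse. At an approximant of
    [x] it is the condition on [y] tested on the flipped pair; the limit gives it at [x]. *)
Lemma epi_fenchel A x y c d : nonneg_selfadjoint dot A ->
  epi A x d -> epi (A^-1)%relation y c -> 2 * rdot x y <= c + d.
Proof.
move=> hA hx hy; have [f [Af _ fd fx]] := epi_approx_seq hA hx.
have c1 : (fun n => 2 * rdot (f n).1 y) @ \oo --> 2 * rdot x y.
  by apply: cvgM; [exact: cvg_cst|apply: cvg_rdot => //; exact: cvg_cst].
apply: ler_cvg_to c1 (cvg_cst (c + d)) _; apply: nearW => n.
have Ai : (A^-1)%relation ((f n).2, (f n).1) by rewrite /= -surjective_pairing.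
by have := hy _ Ai; have := fd n; rewrite /= (rdotC (f n).1 (f n).2); lra.
Qed.

Lemma inv_invE A : ((A^-1)^-1)%relation = A.
Proof. by apply/seteqP; split => [[x y]|[x y]]. Qed.

Lemma nsa_inv A : nonneg_selfadjoint dot A -> nonneg_selfadjoint dot (A^-1)%relation.
Proof.
move=> hA; have [A0 AL _] := nsa_subspace hA; apply: nsaI => //=.
- by move=> k [u1 u2] [v1 v2] /= Au Av; have := AL k _ _ Au Av.
- by move=> [f1 f2] [g1 g2] /= Af Ag; have := nsa_sym hA Af Ag.
- by move=> [f1 f2] /= Af; rewrite rdotC; exact: (nsa_ge0 hA Af).
- move=> h; have [[f1 f2] Af e] := nsa_resolvent hA ltr01 h.
  by exists (f2, f1) => //=; rewrite addrC -e scale1r.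
Qed.

(** A pair (g1, g2) of [B] bounds the form of [B], hence that of [A], at g1 by (g2, g1). The Fenchel
    inequality for [A] at g1 and [y] is then the test inequality for the inverse of [B]. *)
Lemma epi_inv_anti A B : nonneg_selfadjoint dot A -> nonneg_selfadjoint dot B ->
  (forall x c, epi B x c -> epi A x c) ->
  forall x c, epi (A^-1)%relation x c -> epi (B^-1)%relation x c.
Proof.
move=> hA hB AB y c hy [g2 g1] /= Bg.
have /AB h := epi_graph hB Bg.
by have /= := epi_fenchel hA h hy; rewrite (rdotC g2); rewrite (rdotC g1 g2); lra.
Qed.

(** A pair (x, y) of [A] and the pair (u, v) of [B] with the same sum are tested against each other;
    the two inequalities add up to (y - v, x - u) >= 0. *)
Lemma epi_sub A B : nonneg_selfadjoint dot A -> nonneg_selfadjoint dot B ->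
  (forall x c, epi A x c <-> epi B x c) -> A `<=` B.
Proof.
move=> hA hB AB [x y] Axy.
have [[u v] Buv] := nsa_resolvent hB ltr01 (x + y); rewrite scale1r /= => e.
have /AB /(_ _ Buv) /= h1 := epi_graph hA Axy.
have /AB /(_ _ Axy) /= h2 := epi_graph hB Buv.
have e2 : y - v = - (x - u) by apply: sum_eq_sub; rewrite e.
have : 0 <= rdot (y - v) (x - u) by rewrite !rdotE; lra.
rewrite e2 rdotNl oppr_ge0 => /sqn_le0/eqP z0; move: e2; rewrite (eqP z0) oppr0 => /eqP.
by move: z0; rewrite !subr_eq0 => /eqP -> /eqP ->.
Qed.

Lemma epi_inj A B : nonneg_selfadjoint dot A -> nonneg_selfadjoint dot B ->
  (forall x c, epi A x c <-> epi B x c) -> A = B.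
Proof.
by move=> hA hB AB; apply/seteqP; split; apply: epi_sub => // x c; split => /AB.
Qed.

(** * Adding a multiple of the identity *)

Definition shift (k : R) A : set (H * H) := [set p | A (p.1, p.2 - k%:C%C *: p.1)].

Lemma nsa_shift k A : 0 <= k -> nonneg_selfadjoint dot A -> nonneg_selfadjoint dot (shift k A).
Proof.
move=> k0 hA; have [A0 AL _] := nsa_subspace hA; rewrite /shift; apply: nsaI => /=.
- by rewrite scaler0 subr0.
- move=> a [u1 u2] [v1 v2] /= Au Av; have := AL a _ _ Au Av.
  congr (A (_, _)) => /=.
  by rewrite scalerBr scalerDr opprD addrACA !scalerA [k%:C%C * _]mulrC.
- move=> [f1 f2] [g1 g2] /= Af Ag; have /= := nsa_sym hA Af Ag.
  by rewrite !rdotE; lra.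
- move=> [f1 f2] /= Af; have /= := nsa_ge0 hA Af; rewrite !rdotE -/(sqn f1) => h.
  by have := mulr_ge0 k0 (sqn_ge0 f1); lra.
- move=> h; have k1 : 0 < 1 + k by lra.
  (* Dividing f1 + (f2 + k f1) = h by 1 + k gives the resolvent equation of [A] with parameter 1 /
     (1 + k). *)
  have k2 : 0 < (1 + k)^-1 by rewrite invr_gt0.
  have [[f1 f2] Af /= e] := nsa_resolvent hA k2 ((1 + k)^-1%:C%C *: h).
  exists (f1, f2 + k%:C%C *: f1) => /=; first by rewrite addrK.
  have := congr1 (fun z => (1 + k)%:C%C *: z) e => /=.
  rewrite scalerDr !scalerA -!rmorphM /= divff ?gt_eqF // !scale1r => <-.
  by rewrite rmorphD /= scalerDl scale1r -[RHS]addrA [f2 + _]addrC.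
Qed.

(** From right to left, k |x - f|^2 >= 0 is added. From left to right the inequality is immediate at
    the approximants and passes to the limit. *)
Lemma epi_shift k A x c : 0 <= k -> nonneg_selfadjoint dot A ->
  epi (shift k A) x c <-> epi A x (c - k * sqn x).
Proof.
move=> k0 hA; split; last first.
  move=> hx [f1 f2] /= Af; have /= := hx _ Af.
  have := mulr_ge0 k0 (sqn_ge0 (x - f1)); rewrite sqnB !rdotE -/(sqn _) (rdotC f1).
  by lra.
move=> hx; have hS := nsa_shift k0 hA; have [f [Af _ fc fx]] := epi_approx_seq hS hx.
move=> g Ag.
have c1 : (fun n => 2 * rdot g.2 (f n).1 - rdot g.2 g.1) @ \oo --> 2 * rdot g.2 x - rdot g.2 g.1.
  apply: cvgB; last exact: cvg_cst.
  by apply: cvgM; [exact: cvg_cst|apply: cvg_rdot => //; exact: cvg_cst].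
have c2 : (fun n => c - k * sqn (f n).1) @ \oo --> c - k * sqn x.
  apply: cvgB; first exact: cvg_cst.
  by apply: cvgM; [exact: cvg_cst|apply: cvg_rdot].
apply: ler_cvg_to c1 c2 _; apply: nearW => n.
have /= := epi_graph hA (Af n) Ag; have := fc n.
by rewrite !rdotE -/(sqn _); lra.
Qed.

(** * Monotone sequences and Yosida approximants *)

Lemma monotone_cauchy (s : nat -> R) c : (forall m n, (m <= n)%N -> s m <= s n) ->
  (forall n, s n <= c) ->
  forall e, 0 < e -> exists N, forall m n, (N <= m)%N -> s n - s m < e.
Proof.
move=> smono sc e e0.
have hs : has_sup (range s) by split; [exists (s 0%N), 0%N | exists c => _ [n _ <-]].
have [_ [N _ <-] hN] := sup_adherent e0 hs.
exists N => m n Nm; have := smono _ _ Nm.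
have : s n <= sup (range s) by apply: ub_le_sup; [case: hs|exists n].
by lra.
Qed.

(** [s] increases because squared norms are nonnegative; being bounded it is Cauchy, and its
    increments control those of [u]. *)
Lemma monotone_sqn_cvg (u : nat -> H) (s : nat -> R) c :
  (forall m n, (m <= n)%N -> sqn (u n - u m) <= s n - s m) ->
  (forall n, s n <= c) -> exists l : H, u @ \oo --> l.
Proof.
move=> us sc; apply: sqn_cauchy_cvg => e e0.
have [|N hN] := monotone_cauchy _ sc e0.
  by move=> m n /us h; have := sqn_ge0 (u n - u m); lra.
exists N => m n Nm Nn; have [mn|/ltnW nm] := leqP m n.
  by rewrite -sqnN opprB; apply: le_lt_trans (us _ _ mn) (hN _ _ Nm).
by apply: le_lt_trans (us _ _ nm) (hN _ _ Nn).
Qed.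

(* For [P = |p|^2], [Q = |q|^2], [r = (p, q)] and Yosida approximants [p], [q] of [A x]
   with parameters [m <= l], the last hypothesis is the monotonicity of [A]. *)
Lemma yosida_ineq (P Q r l m : R) : 0 <= P -> 0 < m -> m <= l -> r ^+ 2 <= P * Q ->
  l * P + m * Q <= (l + m) * r -> m * r <= l * P.
Proof.
move=> P0 m0 ml rPQ h; rewrite leNgt; apply/negP => h1.
have r0 : 0 < r.
  by rewrite -(pmulr_rgt0 _ m0); apply: le_lt_trans h1; rewrite mulr_ge0 //; lra.
have h2 : l * P < l * r by apply: (lt_le_trans h1); rewrite ler_pM2r.
have h3 : P < r by move: h2; rewrite ltr_pM2l //; lra.
(* The right-hand sides of [h4], [h5] and [h6] add up to 0 identically, a contradiction. *)
have h4 : 0 < (r - P) * (m * r - l * P) by rewrite mulr_gt0 // subr_gt0.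
have h5 : 0 <= ((l + m) * r - (l * P + m * Q)) * P by rewrite mulr_ge0 // subr_ge0.
have h6 : 0 <= m * (P * Q - r ^+ 2) by rewrite mulr_ge0 ?subr_ge0 // ltW.
by lra.
Qed.

(** * Von Neumann's theorem *)

(* [M^* M]; for [M] a form root of [A], this is [A] itself. *)
Definition gram M : set (H * H) := (adjoint dot M \; M)%relation.

Lemma gram_intro M x z y : closed_subspace M -> M (x, z) ->
  (forall q, M q -> rdot q.2 z = rdot q.1 y) -> gram M (x, y).
Proof.
move=> cM Mx h; exists z => //.
by apply: (@rdot_adjoint M (z, y)) => // a f; exact: subspaceZ.
Qed.

Lemma gram_elim M f : gram M f -> exists2 z, M (f.1, z) &
  forall q, M q -> rdot q.2 z = rdot q.1 f.2.
Proof. by case=> z Mz hz; exists z => // q Mq; exact: (adjoint_rdot hz). Qed.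

Lemma nsa_gram M : closed_subspace M -> nonneg_selfadjoint dot (gram M).
Proof.
move=> cM; have [M0 ML clM] := cM; apply: nsaI.
- by apply: (@gram_intro _ _ 0) => // q _; rewrite !rdotE.
- move=> k u v /gram_elim[z Mz hz] [w Mw hw]; exists (k *: z + w).
    exact: (ML k _ _ Mz Mw).
  case: (@adjoint_closed_subspace M); first by move=> a f; exact: subspaceZ.
  move=> _ L _; apply: (L k (z, u.2) (w, v.2)) => //.
  by apply: rdot_adjoint => // a f; exact: subspaceZ.
- move=> f g /gram_elim[z Mz hz] /gram_elim[w Mw hw].
  by rewrite rdotC -(hz _ Mw) -(hw _ Mz) rdotC.
- by move=> f /gram_elim[z Mz hz]; rewrite rdotC -(hz _ Mz) sqn_ge0.
(* The residual (h - p.1, - p.2) of (h, 0) is orthogonal to [M], which says that (p.2, h - p.1) lies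
   in the adjoint of [M]. *)
- move=> h; have [p Mp hp] := projection_pair (h, 0) M0 ML (closed_seq clM).
  exists (p.1, h - p.1) => /=; last by rewrite addrC subrK.
  apply: (@gram_intro _ _ p.2) => // [|q Mq]; first by rewrite -surjective_pairing.
  have := hp q Mq; rewrite /pair_dot /= sub0r rdotNl (rdotC p.2) (rdotC (h - _)).
  by lra.
Qed.

(** The substance is that a finite form value at [x] puts [x] in the domain of [M]: over the
    approximants of [x], the second components [z n] have increasing squared norms bounded by [c],
    so they converge and closedness of [M] applies. *)
Lemma epi_gram M x c : closed_subspace M ->
  epi (gram M) x c <-> exists2 z, M (x, z) & sqn z <= c.
Proof.
move=> cM; have [M0 ML clM] := cM; have hT := nsa_gram cM; split; last first.
  move=> [z Mz zc] f /gram_elim[w Mw hw].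
  have := hw _ Mz; have := hw _ Mw; rewrite /= (rdotC f.2) (rdotC f.2 f.1) -/(sqn _) => <- <-.
  by have := sqn_ge0 (z - w); rewrite sqnB; lra.
move=> hx; have [f [Tf fe fc fx]] := epi_approx_seq hT hx.
have /choice[z hz] n : exists z, M ((f n).1, z) /\ forall q, M q -> rdot q.2 z = rdot q.1 (f n).2.
  by have [z Mz h] := gram_elim (Tf n); exists z.
have sz n : sqn (z n) = rdot (f n).2 (f n).1.
  by have [Mz h] := hz n; rewrite /sqn (h _ Mz) rdotC.
have mono m n : (m <= n)%N -> sqn (z n - z m) <= sqn (z n) - sqn (z m).
  move=> mn; set l : R := m.+1%:R^-1; set k : R := n.+1%:R^-1.
  have k0 : 0 < k by rewrite invr_gt0.
  have kl : k <= l by rewrite lef_pV2 ?posrE // ler_nat.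
  have ef : (f n).1 = (f m).1 + (l%:C%C *: (f m).2 - k%:C%C *: (f n).2).
    by rewrite addrA fe -(fe n) addrK.
  have hmn : rdot (z n) (z m) = rdot (f m).2 (f n).1.
    by have [Mn _] := hz n; have [_ hm] := hz m; rewrite (hm _ Mn) rdotC.
  have h1 := nsa_ge0 hT (subspaceB (nsa_subspace hT) (Tf n) (Tf m)).
  have {}h1 : 0 <= rdot ((f n).2 - (f m).2) (l%:C%C *: (f m).2 - k%:C%C *: (f n).2).
    by move: h1 => /=; rewrite ef [(f m).1 + _ - _]addrAC subrr add0r.
  (* Once [z n] and [z m] are expressed through [f], this inequality is what remains to be shown. *)
  have {}h1 : k * rdot (f m).2 (f n).2 <= l * sqn (f m).2.
    apply: (@yosida_ineq _ (sqn (f n).2)) => //; first exact: sqn_ge0.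
      exact: rdot_sqr_le.
    by move: h1; rewrite !rdotE -!/(sqn _) (rdotC (f n).2 (f m).2); lra.
  rewrite sqnB hmn ef !rdotE -/(sqn _) (sz m).
  by move: h1; lra.
have zc n : sqn (z n) <= c by rewrite sz.
have [z0 cz] := monotone_sqn_cvg mono zc.
exists z0; first by apply: (closed_seq clM (u := fun n => ((f n).1, z n))) => //= n; case: (hz n).
have c1 : (fun n => sqn (z n)) @ \oo --> sqn z0 by apply: cvg_rdot.
by apply: ler_cvg_to c1 (cvg_cst c) _; exact: nearW.
Qed.

(** * Square roots *)

Lemma cvgH_unique (u : nat -> H) (x y : H) : u @ \oo --> x -> u @ \oo --> y -> x = y.
Proof. exact: cvg_unique. Qed.

(** The triangle inequality for norm bounds, kept in squared form. *)
Lemma sqnD_bound (a b : R) x y n : 0 <= a -> 0 <= b -> 0 <= n ->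
  sqn x <= a ^+ 2 * n -> sqn y <= b ^+ 2 * n -> sqn (x + y) <= (a + b) ^+ 2 * n.
Proof.
move=> a0 b0 n0 hx hy; rewrite sqnD.
suff : rdot x y <= a * b * n by lra.
have abn : 0 <= a * b * n by rewrite !mulr_ge0.
rewrite (le_trans (ler_norm _))// -ler_sqr ?nnegrE// real_normK ?num_real//.
apply: (le_trans (rdot_sqr_le _ _)).
rewrite (_ : (a * b * n) ^+ 2 = (a ^+ 2 * n) * (b ^+ 2 * n)); last by ring.
by apply: ler_pM => //; exact: sqn_ge0.
Qed.

Definition lin (T : H -> H) := forall k u v, T (k *: u + v) = k *: T u + T v.

Lemma lin0 T : lin T -> T 0 = 0.
Proof. by move=> hT; have := hT (-1) 0 0; rewrite scaler0 addr0 scaleN1r addNr. Qed.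

Lemma linZ T : lin T -> forall k u, T (k *: u) = k *: T u.
Proof. by move=> hT k u; have := hT k u 0; rewrite (lin0 hT) !addr0. Qed.

Lemma linD T : lin T -> forall u v, T (u + v) = T u + T v.
Proof. by move=> hT u v; have := hT 1 u v; rewrite !scale1r. Qed.

Lemma linB T : lin T -> forall u v, T (u - v) = T u - T v.
Proof. by move=> hT u v; rewrite linD // -scaleN1r linZ // scaleN1r. Qed.

Definition contraction (T : H -> H) := lin T /\ forall x, sqn (T x) <= sqn x.

Definition symmetric_map (T : H -> H) := forall x y, rdot (T x) y = rdot x (T y).

Lemma contraction_cvg T (u : nat -> H) x : contraction T -> u @ \oo --> x ->
  (fun n => T (u n)) @ \oo --> T x.
Proof.
move=> [lT cT] /cvg_sqn hu; apply/cvg_sqn.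
apply: (@squeeze_cvgr _ _ _ _ (cst 0) (fun n => sqn (u n - x))) => //; last exact: cvg_cst.
by apply: nearW => n; rewrite /cst sqn_ge0 -(linB lT) cT.
Qed.

(* The iteration tends to [1 - (1 - T)^(1/2)]; [root_bound] is the same iteration for
   the number [1], and its increments bound those of [root_iter] in norm. *)
Fixpoint root_iter (T : H -> H) n : H -> H :=
  if n is m.+1 then fun x => (2^-1)%:C%C *: (T x + root_iter T m (root_iter T m x))
  else fun _ => 0.

Fixpoint root_bound n : R := if n is m.+1 then 2^-1 * (1 + root_bound m ^+ 2) else 0.

Lemma root_bound_itv n : 0 <= root_bound n <= 1.
Proof.
elim: n => [|n /andP[h0 h1]] /=; first by rewrite lexx ler01.
have : root_bound n ^+ 2 <= 1 by rewrite exprn_ile1.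
by have := sqr_ge0 (root_bound n); move=> ? ?; apply/andP; split; lra.
Qed.

Lemma root_bound_step n : root_bound n <= root_bound n.+1.
Proof.
rewrite /=; have := sqr_ge0 (1 - root_bound n); rewrite sqrrB expr1n mul1r.
by lra.
Qed.

Lemma root_bound_mono m n : (m <= n)%N -> root_bound m <= root_bound n.
Proof.
move=> /subnK <-; elim: (n - m)%N => // k; rewrite addSn => h.
exact: le_trans h (root_bound_step _).
Qed.

Section RootIter.
Variable T : H -> H.
Hypothesis cT : contraction T.
Hypothesis sT : symmetric_map T.

Lemma root_iter_lin n : lin (root_iter T n).
Proof.
have [lT _] := cT; elim: n => [|n IH] k u v /=; first by rewrite scaler0 addr0.
rewrite lT !IH scalerA mulrC -scalerA -scalerDr; congr (_ *: _).
by rewrite scalerDr addrACA.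
Qed.

Lemma root_iter_sym n : symmetric_map (root_iter T n).
Proof.
elim: n => [|n IH] x y /=; first by rewrite !rdotE.
by rewrite !rdotE sT !IH.
Qed.

(** Each iterate is a polynomial in [T]. *)
Lemma root_iter_comm Z : lin Z -> (forall x, Z (T x) = T (Z x)) ->
  forall n x, Z (root_iter T n x) = root_iter T n (Z x).
Proof.
move=> lZ ZT; elim=> [|n IH] x /=; first by rewrite (lin0 lZ).
by rewrite (linZ lZ) (linD lZ) ZT !IH.
Qed.

Lemma root_iter_bound n x : sqn (root_iter T n x) <= root_bound n ^+ 2 * sqn x.
Proof.
have [lT bT] := cT; elim: n x => [|n IH] x /=.
  by rewrite sqn0 mulr_ge0 ?sqr_ge0 ?sqn_ge0.
have /andP[y0 y1] := root_bound_itv n.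
rewrite sqnZ exprMn -[leRHS]mulrA ler_pM2l ?exprn_gt0 ?invr_gt0 //.
apply: sqnD_bound => //; rewrite ?sqr_ge0 ?sqn_ge0 //.
  by rewrite expr1n mul1r.
apply: le_trans (IH _) _; rewrite [in leRHS]expr2 -mulrA ler_wpM2l ?sqr_ge0 //.
Qed.

Lemma root_iter_comm_iter m n x :
  root_iter T m (root_iter T n x) = root_iter T n (root_iter T m x).
Proof.
apply: root_iter_comm; first exact: root_iter_lin.
by move=> y; rewrite -root_iter_comm //; case: cT.
Qed.

(** Since the iterates commute, Y'^2 - Y^2 = (Y' + Y)(Y' - Y); the same factorization of the
    increments of [root_bound] matches it term by term. *)
Lemma root_iter_step n x :
  sqn (root_iter T n.+1 x - root_iter T n x) <=
  (root_bound n.+1 - root_bound n) ^+ 2 * sqn x.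
Proof.
elim: n x => [|n IH] x.
  by have := root_iter_bound 1 x; rewrite [root_bound 0]/= !subr0.
set Y := root_iter T n; set Y' := root_iter T n.+1; set d := Y' x - Y x.
have -> : root_iter T n.+2 x - Y' x = (2^-1)%:C%C *: (Y' d + Y d).
  rewrite [root_iter T n.+2 x]/= [in X in _ - X]/Y' [in X in _ - X]/= -scalerBr; congr (_ *: _).
  have lY' : lin Y' := root_iter_lin n.+1; have lY : lin Y := root_iter_lin n.
  rewrite /d (linB lY') (linB lY).
  rewrite [Y (Y' x)]root_iter_comm_iter -/Y -/Y' addrA subrK.
  by rewrite opprD addrACA subrr add0r.
have -> : root_bound n.+2 - root_bound n.+1 =
   2^-1 * ((root_bound n.+1 + root_bound n) * (root_bound n.+1 - root_bound n)).
  have e2 : root_bound n.+2 = 2^-1 * (1 + root_bound n.+1 ^+ 2) by [].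
  have e1 : root_bound n.+1 = 2^-1 * (1 + root_bound n ^+ 2) by [].
  by move: e2 e1; move: (root_bound n.+2) (root_bound n.+1) (root_bound n) => *; lra.
rewrite sqnZ exprMn -[leRHS]mulrA ler_pM2l ?exprn_gt0 ?invr_gt0 // exprMn -mulrA.
have /andP[y0 _] := root_bound_itv n; have /andP[y1 _] := root_bound_itv n.+1.
apply: (@le_trans _ _ ((root_bound n.+1 + root_bound n) ^+ 2 * sqn d)); last first.
  by rewrite ler_wpM2l ?sqr_ge0 //; exact: IH.
by apply: sqnD_bound => //; [exact: sqn_ge0 | exact: root_iter_bound | exact: root_iter_bound].
Qed.

Lemma root_iter_diff m n x : (m <= n)%N ->
  sqn (root_iter T n x - root_iter T m x) <= (root_bound n - root_bound m) ^+ 2 * sqn x.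
Proof.
move=> /subnK <-; elim: (n - m)%N => [|k IH].
  by rewrite add0n !subrr sqn0 expr0n mul0r.
have -> : root_iter T (k.+1 + m) x - root_iter T m x =
  (root_iter T (k + m).+1 x - root_iter T (k + m) x) + (root_iter T (k + m) x - root_iter T m x).
  by rewrite addrA subrK.
have -> : root_bound (k.+1 + m) - root_bound m =
  (root_bound (k + m).+1 - root_bound (k + m)) + (root_bound (k + m) - root_bound m).
  by rewrite addrA subrK.
apply: sqnD_bound => //; rewrite ?subr_ge0 ?sqn_ge0 //.
- exact: root_bound_step.
- by apply: root_bound_mono; rewrite leq_addl.
- exact: root_iter_step.
Qed.

Lemma root_iter_cvg x : exists y : H, (fun n => root_iter T n x) @ \oo --> y.
Proof.
(* The increments of [root_bound] lie in [0, 1], so their squares are at most the increments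
   themselves. *)
apply: (@monotone_sqn_cvg _ (fun n => root_bound n * sqn x) (sqn x)) => [m n mn|n]; last first.
  by rewrite ler_piMl ?sqn_ge0 //; case/andP: (root_bound_itv n).
apply: le_trans (root_iter_diff x mn) _; rewrite -mulrBl ler_wpM2r ?sqn_ge0 //.
have /andP[m0 _] := root_bound_itv m; have /andP[_ n1] := root_bound_itv n.
have := root_bound_mono mn => h.
by rewrite expr2 ler_piMl; lra.
Qed.

(** [X] is 1 - Y for the limit [Y] of the iterates: the recursion becomes Y^2 = 2 Y - T, that is X^2
    = 1 - T. Commutation passes from [T] to the iterates and to their limit. *)
Lemma contraction_root : exists X : H -> H, [/\ contraction (fun x => x - X x),
  symmetric_map X, forall x, X (X x) = x - T x, forall x, 0 <= rdot (X x) x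
  & forall Z, contraction Z -> (forall x, Z (T x) = T (Z x)) -> forall x, Z (X x) = X (Z x)].
Proof.
have [lT bT] := cT.
have [Y hY] := choice root_iter_cvg.
have lY : lin Y.
  move=> k u v; apply: cvgH_unique (hY _) _.
  rewrite (_ : (fun n => _) = fun n => k *: root_iter T n u + root_iter T n v); last first.
    by apply/funext => n; rewrite root_iter_lin.
  by apply: cvgD => //; exact: cvgZr.
have bY x : sqn (Y x) <= sqn x.
  have c1 : (fun n => sqn (root_iter T n x)) @ \oo --> sqn (Y x) by apply: cvg_rdot.
  apply: ler_cvg_to c1 (cvg_cst _) _; apply: nearW => n.
  apply: le_trans (root_iter_bound n x) _; have /andP[n0 n1] := root_bound_itv n.
  by rewrite ler_piMl ?sqn_ge0 // exprn_ile1.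
have YY x : Y (Y x) = Y x + Y x - T x.
  have c1 : (fun n => root_iter T n (root_iter T n x)) @ \oo --> Y (Y x).
    (* The iterates are contractions, so replacing the inner one by its limit costs a term that
       tends to 0. *)
    rewrite (_ : (fun n => _) = fun n => root_iter T n (root_iter T n x - Y x) + root_iter T n (Y x)).
      rewrite -[X in _ --> X]add0r; apply: cvgD => //.
      apply/cvg_sqn; apply: (@squeeze_cvgr _ _ _ _ (cst 0) (fun n => sqn (root_iter T n x - Y x))).
      - apply: nearW => n; rewrite /cst sqn_ge0 subr0 /=.
        apply: le_trans (root_iter_bound n _) _; have /andP[n0 n1] := root_bound_itv n.
        by rewrite ler_piMl ?sqn_ge0 // exprn_ile1.
      - exact: cvg_cst.
      - by apply/cvg_sqn.
    by apply/funext => n; rewrite -(linD (root_iter_lin n)) subrK.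
  have c2 : (fun n => root_iter T n.+1 x + root_iter T n.+1 x - T x) @ \oo --> Y x + Y x - T x.
    apply: cvgB; last exact: cvg_cst.
    by apply: cvgD; have := hY x; rewrite -(cvg_shiftS (fun n => root_iter T n x)).
  apply: cvgH_unique c1 _; rewrite (_ : (fun n => _) =
      (fun n => root_iter T n.+1 x + root_iter T n.+1 x - T x)) //.
  apply/funext => n /=; rewrite -scalerDl -rmorphD (_ : 2^-1 + 2^-1 = 1); last by field.
  by rewrite rmorph1 scale1r addrC addKr.
exists (fun x => x - Y x); split.
- rewrite (_ : (fun x => _) = Y); last by apply/funext => x; rewrite opprB addrC subrK.
  by split.
- move=> x y; rewrite !rdotE; congr (_ - _).
  have c1 : (fun n => rdot (root_iter T n x) y) @ \oo --> rdot (Y x) y.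
    by apply: cvg_rdot => //; exact: cvg_cst.
  have c2 : (fun n => rdot x (root_iter T n y)) @ \oo --> rdot x (Y y).
    by apply: cvg_rdot => //; exact: cvg_cst.
  have e : (fun n => rdot (root_iter T n x) y) = (fun n => rdot x (root_iter T n y)).
    by apply/funext => n; rewrite root_iter_sym.
  by rewrite e in c1; exact: cvg_unique c1 c2.
- move=> x; rewrite (linB lY) YY opprB.
  by rewrite [Y x + Y x - _ - _]addrAC addrK addrA subrK.
- move=> x; rewrite rdotDl rdotNl subr_ge0 -/(sqn x).
  rewrite (le_trans (ler_norm _))// -ler_sqr ?nnegrE ?sqn_ge0// real_normK ?num_real//.
  apply: (le_trans (rdot_sqr_le _ _)).
  by rewrite expr2 ler_wpM2r ?sqn_ge0.
- move=> Z cZ ZT x; have [lZ _] := cZ; rewrite (linB lZ); congr (_ - _).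
  apply: cvgH_unique (contraction_cvg cZ (hY x)) _.
  rewrite (_ : (fun n => _) = (fun n => root_iter T n (Z x))) //.
  by apply/funext => n; rewrite root_iter_comm.
Qed.

End RootIter.


(** * The multivalued part and the root of a relation *)

Lemma mul_partZ A : closed_subspace A -> forall k m, mul_part A m -> mul_part A (k *: m).
Proof.
move=> cA k m Am; have := subspaceZ cA k Am.
have e : k *: ((0, m) : H * H) = (0, k *: m).
  by rewrite [LHS](_ : _ = (k *: 0, k *: m)) // scaler0.
by rewrite e.
Qed.

Lemma mul_complementP A x : closed_subspace A ->
  (forall m, A (0, m) -> rdot x m = 0) -> mul_complement dot A x.
Proof.
move=> cA h m Am; apply/eqP; rewrite eq_complex; apply/andP; split; apply/eqP.
  exact: h.
by rewrite dot_im rdot_i opprK; apply: h; exact: (mul_partZ cA).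
Qed.

Lemma mul_complement_rdot A x m : mul_complement dot A x -> A (0, m) -> rdot x m = 0.
Proof. by move=> h Am; rewrite /rdot (h m Am). Qed.

Lemma nsa_dom_mul_complement A f : nonneg_selfadjoint dot A -> A f ->
  mul_complement dot A f.1.
Proof.
move=> hA Af; apply: mul_complementP => [|m Am]; first exact: nsa_subspace.
by have := nsa_sym hA Am Af; rewrite /= rdot0l rdotC.
Qed.

Lemma mul_complement_decomp A y : closed_subspace A ->
  exists2 m, A (0, m) & mul_complement dot A (y - m).
Proof.
move=> cA; have [A0 AL clA] := cA.
pose M : set (H * H) := [set p | p.1 = 0 /\ A p].
have [||| [p1 p2] [/= -> Am] hp] := @projection_pair M (0, y).
- by split.
- move=> k u v [u1 Au] [v1 Av]; split; last exact: AL.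
  by rewrite /= u1 v1 scaler0 addr0.
- move=> u x z Mu ux uz; have u0 : (fun n => (u n).1) = cst 0 by apply/funext => n; case: (Mu n).
  split; first by rewrite u0 in ux; apply: cvg_unique ux (cvg_cst _).
  by apply: closed_seq ux uz => // n; case: (Mu n).
exists p2 => //; apply: mul_complementP => // m Am0.
by have := hp (0, m); rewrite /pair_dot /= rdot0r add0r; apply; split.
Qed.

Lemma mul_complement_subspace A : closed_subspace A ->
  forall k u v, mul_complement dot A u -> mul_complement dot A v ->
    mul_complement dot A (k *: u + v).
Proof.
move=> cA k u v hu hv m Am.
have hZ (x y : H) : dot (k *: x) y = k * dot x y by rewrite linearZl_LR.
have hD (x y z : H) : dot (x + y) z = dot x z + dot y z by rewrite linearDl.
by rewrite hD hZ hu // hv // mulr0 addr0.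
Qed.

(* Adding the pairs [(0, m)] and [(m, 0)] to [S] turns the restriction to the
   complement of [mul A] into part of an adjoint, and adjoints are closed. *)
Lemma selfadjoint_in_closed A (S : set (H * H)) : closed_subspace A ->
  (forall k f, S f -> S (k *: f)) ->
  S = adjoint dot S `&` (mul_complement dot A `*` mul_complement dot A) ->
  closed_subspace S.
Proof.
move=> cA SZ e.
pose S' : set (H * H) := [set f | [\/ S f, f.1 = 0 /\ A (0, f.2) | A (0, f.1) /\ f.2 = 0]].
have SZ' k f : S' f -> S' (k *: f).
  case=> [Sf|[f1 Af]|[Af f2]].
  - by apply: Or31; exact: SZ.
  - by apply: Or32; split; [rewrite /= f1 scaler0 | exact: (mul_partZ cA)].
  - by apply: Or33; split; [exact: (mul_partZ cA) | rewrite /= f2 scaler0].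
rewrite (_ : S = adjoint dot S'); first exact: adjoint_closed_subspace.
apply/seteqP; split => g.
  rewrite {1}e => -[hg [/= g1 g2]]; apply: rdot_adjoint => // f.
  case=> [Sf|[f1 Af]|[Af f2]]; first exact: (adjoint_rdot hg).
    by rewrite f1 rdot0l rdotC; exact: mul_complement_rdot Af.
  by rewrite f2 rdot0l rdotC; apply/esym; exact: mul_complement_rdot Af.
move=> /adjoint_rdot hg; rewrite e; split.
  by apply: rdot_adjoint => // f Sf; apply: hg; exact: Or31.
split; apply: mul_complementP => // m Am.
  have := hg (0, m); rewrite /= rdot0l rdotC; apply.
  by apply: Or32.
have := hg (m, 0); rewrite /= rdot0l (rdotC m) => <- //.
by apply: Or33.
Qed.

(** Nonnegativity of (h - B h, B h) gives |B h|^2 + |h - B h|^2 <= |h|^2, hence both contraction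
    bounds. *)
Lemma nsa_resolvent_map A : nonneg_selfadjoint dot A ->
  exists B : H -> H, [/\ contraction B, contraction (fun x => x - B x), symmetric_map B
    & forall h, A (B h, h - B h)].
Proof.
move=> hA; have [A0 AL _] := nsa_subspace hA.
have /choice[B hB] h : exists f, A (f, h - f).
  have [[f1 f2] Af] := nsa_resolvent hA ltr01 h; rewrite scale1r /= => <-.
  by exists f1; rewrite addrC addKr.
have lB : lin B.
  move=> k u v; have h1 := AL k _ _ (hB u) (hB v).
  have h2 := hB (k *: u + v).
  suff : (B (k *: u + v), k *: u + v - B (k *: u + v)) =
         (k *: B u + B v, k *: (u - B u) + (v - B v)) by case.
  apply: (nsa_resolvent_inj hA) => //=.
  by rewrite addrC subrK addrACA -scalerDr ![B _ + _]addrC !subrK.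
have bB h : sqn (B h) + sqn (h - B h) <= sqn h.
  have := nsa_ge0 hA (hB h); have := sqnD (B h) (h - B h).
  by rewrite [B h + _]addrC subrK rdotC /=; lra.
exists B; split => //.
- by split => // h; have := bB h; have := sqn_ge0 (h - B h); lra.
- split; last by move=> h; have := bB h; have := sqn_ge0 (B h); lra.
  by move=> k u v; rewrite lB scalerBr opprD addrACA.
- move=> x y; have := nsa_sym hA (hB x) (hB y); rewrite /= !rdotE; lra.
Qed.

Lemma lin_subid (X : H -> H) : lin (fun x => x - X x) -> lin X.
Proof.
move=> l k u v; rewrite -(subKr (k *: u + v) (X _)) l scalerBr opprD addrACA.
by rewrite !subKr.
Qed.

(** The roots [C] of B and [D] of 1 - B commute and satisfy C^2 + D^2 = 1, which inverts h -> (C h,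
    D h). The kernel of [C] is the multivalued part of [A], so restricting h to its complement [K]
    makes [S] an operator. *)
Lemma relation_root A : nonneg_selfadjoint dot A ->
  exists S, [/\ nonneg_selfadjoint_in dot (mul_complement dot A) S, is_operator S
    & (S \; S)%relation = operator_part dot A].
Proof.
move=> hA; have cA := nsa_subspace hA.
have [B [cB cIB sB AB]] := nsa_resolvent_map hA; have [lB bB] := cB.
have sIB : symmetric_map (fun x => x - B x) by move=> x y; rewrite !rdotE sB.
have [C [cIC sC CC C0 commC]] := contraction_root cIB sIB.
have [D [cID sD DD D0 commD]] := contraction_root cB sB.
have {}CC x : C (C x) = B x by rewrite CC opprB addrC subrK.
have lC : lin C by case: cIC => /lin_subid.
have lD : lin D by case: cID => /lin_subid.
have Bge0 x : 0 <= rdot (B x) x by rewrite -CC sC sqn_ge0.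
have cC : contraction C.
  split => // x; rewrite {1}/sqn sC CC.
  have := sqn_ge0 (x - B x); rewrite sqnB; have := bB x.
  by lra.
have cD : contraction D.
  split => // x; rewrite {1}/sqn sD DD !rdotE (rdotC x (B x)) -/(sqn x).
  by have := Bge0 x; lra.
have CD x : C (D x) = D (C x).
  by apply: (commD C cC) => y; rewrite -!CC.
(* [E] is a root of [C] commuting with [D]; it gives the nonnegativity of [S] through (D h, C h) =
   (D E h, E h). *)
have [E [cIE sE EE _ commE]] : exists E : H -> H, [/\ contraction (fun x => x - E x),
  symmetric_map E, forall x, E (E x) = C x, True &
  forall Z, contraction Z -> (forall x, Z (C x) = C (Z x)) -> forall x, Z (E x) = E (Z x)].
  have [|E [cIE sE EE E0 commE]] := contraction_root cIC; first by move=> x y; rewrite !rdotE sC.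
  exists E; split => // [x|Z cZ ZC x]; first by rewrite EE opprB addrC subrK.
  by apply: commE => // y; rewrite (linB (proj1 cZ)) ZC.
have DE x : D (E x) = E (D x) by apply: commE => // y; rewrite CD.
have DD' x : D (D x) = x - B x by exact: DD.
pose K := mul_complement dot A.
have KL : forall k u v, K u -> K v -> K (k *: u + v) := mul_complement_subspace cA.
have KD u v : K u -> K v -> K (u + v) by move=> Ku Kv; rewrite -[u]scale1r; apply: KL.
have KB x : K (B x) by exact: (nsa_dom_mul_complement hA (AB x)).
have kerC m : A (0, m) -> C m = 0.
  move=> Am; apply: sqn_eq0; rewrite /sqn sC CC.
  suff -> : B m = 0 by rewrite rdot0r.
  have := nsa_resolvent_inj hA (AB m) Am; rewrite /= add0r addrC subrK.
  by move=> /(_ erefl) [].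
have Cker m : C m = 0 -> A (0, m).
  by move=> Cm; have := AB m; rewrite -CC Cm (lin0 lC) subr0.
have KC x : K (C x).
  by apply: mul_complementP => // m Am; rewrite sC kerC // rdot0r.
have KDD x : K x -> K (D x).
  move=> Kx; apply: mul_complementP => // m Am; rewrite sD.
  apply: (mul_complement_rdot Kx); apply: Cker; by rewrite CD kerC // (lin0 lD).
have K0 x : K x -> A (0, x) -> x = 0.
  by move=> Kx Ax; apply: sqn_eq0; exact: mul_complement_rdot Kx Ax.
have CDid x : C (C x) + D (D x) = x by rewrite CC DD' addrC subrK.
pose S : set (H * H) := [set f | exists2 h, K h & f = (C h, D h)].
have SZ k f : S f -> S (k *: f).
  move=> [h Kh ->]; exists (k *: h).
    by rewrite -[k *: h]addr0; apply: KL => //; move=> m _; rewrite linear0l.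
  by rewrite (linZ lC) (linZ lD).
have Ssym f g : S f -> S g -> rdot f.2 g.1 = rdot f.1 g.2.
  by move=> [h _ ->] [k _ ->] /=; rewrite sD -CD sC.
have eS : S = adjoint dot S `&` (K `*` K).
  apply/seteqP; split => g.
    move=> Sg; split; first by apply: rdot_adjoint => // f Sf; exact: Ssym.
    by case: Sg => h Kh -> /=; split; [exact: KC | exact: KDD].
  move=> [/adjoint_rdot hg [/= K1 K2]].
  (* With d the difference of the two sides, testing on (C d, D d) gives |d|^2 = 0. *)
  have e0 : D g.1 = C g.2.
    apply/eqP; rewrite -subr_eq0; apply/eqP.
    have Kd : K (D g.1 - C g.2).
      by rewrite addrC -scaleN1r; apply: KL; [exact: KC|exact: KDD].
    apply: sqn_eq0; rewrite {1}/sqn rdotDr rdotNr -sD -sC.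
    by have /= -> := hg (C (D g.1 - C g.2), D (D g.1 - C g.2)) _; [rewrite subrr|exists (D g.1 - C g.2)].
  (* By [e0] and C^2 + D^2 = 1, this vector is sent to g.1 by [C] and to g.2 by [D]. *)
  exists (C g.1 + D g.2); first by apply: KD; [exact: KC|exact: KDD].
  rewrite (linD lC) (linD lD) CD -e0 CDid -CD e0 CDid.
  by rewrite -surjective_pairing.
exists S; split.
- split => //; first exact: selfadjoint_in_closed cA SZ eS.
  move=> f Sf; apply: (dot_ge0 SZ Ssym Sf).
  by case: Sf => h _ -> /=; rewrite -EE -sE -DE.
- move=> y [h Kh [Ch ->]] /=.
  by rewrite (K0 _ Kh) ?(lin0 lD) //; exact: Cker.
- apply/seteqP; split => [[x y]|[x y]].
    move=> [z [h Kh [-> ->]] [k Kk [e ->]]] /=.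
    (* The two pairs of [S] are joined by D h = C k; hence C u = h and D u = k, so that x = C^2 u =
       B u and y = D^2 u = u - B u. *)
    pose u := C h + D k.
    have Ch : C u = h by rewrite /u (linD lC) CD -e CDid.
    have Dk : D u = k by rewrite /u (linD lD) -CD e CDid.
    split; last by split => /=; [exact: KC|exact: KDD].
    have := AB u; congr (A (_, _)); first by rewrite -Ch CC.
    by rewrite -Dk DD'.
  move=> [Axy [/= Kx Ky]].
  have Ku : K (x + y) by exact: KD.
  have : (x, y) = (B (x + y), x + y - B (x + y)).
    by apply: (nsa_resolvent_inj hA Axy (AB _)); rewrite /= [RHS]addrC subrK.
  (* Here x = C^2 (x + y) and y = D^2 (x + y), so C D (x + y) is the intermediate point. *)
  move=> [ex ey]; exists (D (C (x + y))) => /=.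
    exists (C (x + y)); first exact: KC.
    by rewrite CC -ex.
  exists (D (x + y)); first exact: KDD.
  by rewrite CD DD' -ey.
Qed.

(** * The form of a relation and the order *)

Lemma form_rootP A : nonneg_selfadjoint dot A ->
  [/\ nonneg_selfadjoint_in dot (mul_complement dot A) (form_root dot A),
     is_operator (form_root dot A)
    & (form_root dot A \; form_root dot A)%relation = operator_part dot A].
Proof. by move=> hA; have h := relation_root hA; exact: (getPex h). Qed.

Lemma form_root_subspace A : nonneg_selfadjoint dot A -> closed_subspace (form_root dot A).
Proof. by move=> /form_rootP[[]]. Qed.

(** The adjoint in [gram] is taken in all of H and so restores the multivalued part, which is
    orthogonal to the domain of the root. This gives one inclusion, and selfadjointness gives
    equality. *)
Lemma gram_form_root A : nonneg_selfadjoint dot A -> gram (form_root dot A) = A.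
Proof.
move=> hA; have cA := nsa_subspace hA; have [[cS eS _] _ SS] := form_rootP hA.
apply/esym/nsa_subset => //; first exact: nsa_gram.
move=> [x y] Axy; have [m Am Ky] := mul_complement_decomp y cA.
have Kx := nsa_dom_mul_complement hA Axy.
have : operator_part dot A (x, y - m).
  split => //; have := subspaceB cA Axy Am.
  have e : (x, y) - (0, m) = (x, y - m) :> H * H.
    by rewrite [LHS](_ : _ = (x - 0, y - m)) // subr0.
  by rewrite e.
rewrite -SS => -[z /= Sxz]; rewrite {1}eS => -[/adjoint_rdot hz _].
apply: (gram_intro cS Sxz) => q Sq; rewrite (hz q Sq) /= rdotDr rdotNr.
move: Sq; rewrite eS => -[_ [/= Kq _]].
by rewrite (mul_complement_rdot Kq Am) subr0.
Qed.

Lemma relation_apply_root A x z : nonneg_selfadjoint dot A ->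
  form_root dot A (x, z) -> relation_apply (form_root dot A) x = z.
Proof.
move=> hA Sz; have [_ opS _] := form_rootP hA; have cS := form_root_subspace hA.
have Sg : form_root dot A (x, relation_apply (form_root dot A) x).
  exact: (@getPex _ [set y | form_root dot A (x, y)] (ex_intro _ z Sz)).
have : mul_part (form_root dot A) (relation_apply (form_root dot A) x - z).
  have := subspaceB cS Sg Sz; set w := relation_apply _ _.
  have e : (x, w) - (x, z) = (0, w - z) :> H * H.
    by rewrite [LHS](_ : _ = (x - x, w - z)) // subrr.
  by rewrite e.
by move=> /opS /eqP; rewrite subr_eq0 => /eqP.
Qed.

(** Bridge to the definitions: [epi] describes the epigraph of [form], so order and form sums can be
    handled without roots. *)
Lemma epi_form A x c : nonneg_selfadjoint dot A ->
  epi A x c <-> form_dom dot A x /\ Defs.form dot A x <= c%:C%C.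
Proof.
move=> hA; have cS := form_root_subspace hA.
rewrite -{1}(gram_form_root hA) epi_gram //; split.
  move=> [z Sz zc]; split; first by exists z.
  by rewrite /Defs.form (relation_apply_root hA Sz) norm_dot dot_self lecR.
move=> [[z Sz]]; rewrite /Defs.form (relation_apply_root hA Sz) norm_dot dot_self lecR.
by exists z.
Qed.

Lemma form_real A x : Defs.form dot A x = (complex.Re (Defs.form dot A x))%:C%C.
Proof. by rewrite /Defs.form norm_dot dot_self. Qed.

Lemma relation_leP A B : nonneg_selfadjoint dot A -> nonneg_selfadjoint dot B ->
  relation_le dot A B <-> forall x c, epi B x c -> epi A x c.
Proof.
move=> hA hB; split.
  move=> [dBA fAB] x c /(epi_form _ _ hB)[dx fx]; apply/(epi_form _ _ hA); split; first exact: dBA.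
  exact: le_trans (fAB _ dx) fx.
move=> h; split=> [x dx|x dx].
  have /h/(epi_form _ _ hA)[] // : epi B x (complex.Re (Defs.form dot B x)).
  by apply/epi_form => //; split => //; rewrite -form_real.
have /h/(epi_form _ _ hA)[_] : epi B x (complex.Re (Defs.form dot B x)).
  by apply/epi_form => //; split => //; rewrite -form_real.
by rewrite -form_real.
Qed.

Lemma form_domP A x : nonneg_selfadjoint dot A ->
  form_dom dot A x <-> exists c, epi A x c.
Proof.
move=> hA; split; last by move=> [c /(epi_form _ _ hA)[]].
move=> dx; exists (complex.Re (Defs.form dot A x)).
by apply/epi_form => //; rewrite -form_real.
Qed.

(** [T] shows that the condition behind [get] is solvable, and [epi_inj] that its solution is
    unique. *)
Lemma form_sumE A B T : nonneg_selfadjoint dot A -> nonneg_selfadjoint dot B ->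
  nonneg_selfadjoint dot T ->
  (forall x c, epi T x c <-> exists a b, [/\ epi A x a, epi B x b & a + b <= c]) ->
  form_sum dot A B = T.
Proof.
move=> hA hB hT epiT.
pose P := [set T' | [/\ nonneg_selfadjoint dot T',
    form_dom dot T' = form_dom dot A `&` form_dom dot B
  & forall x, form_dom dot T' x -> Defs.form dot T' x = Defs.form dot A x + Defs.form dot B x]].
have domT : form_dom dot T = form_dom dot A `&` form_dom dot B.
  apply/seteqP; split => x.
    move=> /(form_domP _ hT)[c /epiT[a [b [Aa Bb _]]]].
    by split; [apply/(form_domP _ hA); exists a|apply/(form_domP _ hB); exists b].
  move=> [/(form_domP _ hA)[a Aa] /(form_domP _ hB)[b Bb]]; apply/(form_domP _ hT).
  by exists (a + b); apply/epiT; exists a, b.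
have PT : P T.
  split => // x dx; have := dx; rewrite domT => -[dA dB].
  have eA : epi A x (complex.Re (Defs.form dot A x)) by apply/epi_form => //; rewrite -form_real.
  have eB : epi B x (complex.Re (Defs.form dot B x)) by apply/epi_form => //; rewrite -form_real.
  have eT : epi T x (complex.Re (Defs.form dot T x)) by apply/epi_form => //; rewrite -form_real.
  apply/eqP; rewrite eq_le; apply/andP; split.
    rewrite [Defs.form dot A x]form_real [Defs.form dot B x]form_real -rmorphD.
    apply: (proj2 ((epi_form _ _ hT).1 _)); apply/epiT.
    by do 2 eexists; split; [exact: eA|exact: eB|].
  have [a [b [/(epi_form _ _ hA)[_ fa] /(epi_form _ _ hB)[_ fb] abc]]] := (epiT _ _).1 eT.
  by rewrite [leRHS]form_real (le_trans (lerD fa fb)) // -rmorphD lecR.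
have PS : P (form_sum dot A B) by exact: (getPex (ex_intro P T PT)).
have [hS dS fS] := PS; have [_ _ fT] := PT.
apply: epi_inj => // x c; split.
  move=> /(epi_form _ _ hS)[dx]; rewrite fS // => le.
  by rewrite dS -domT in dx; apply/epi_form => //; rewrite fT.
move=> /(epi_form _ _ hT)[dx]; rewrite fT // => le.
by rewrite domT -dS in dx; apply/epi_form => //; rewrite fS.
Qed.

Lemma resolventE A f : nonneg_selfadjoint dot A -> A f ->
  resolvent A (f.1 + f.2) = f.1.
Proof.
move=> hA Af.
have [g Ag [<- e]] : ((add_identity A)^-1)%relation (f.1 + f.2, resolvent A (f.1 + f.2)).
  apply: (@getPex _ [set y | ((add_identity A)^-1)%relation (f.1 + f.2, y)]).
  by exists f.1; exists f => //=; rewrite addrC.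
by congr (_.1); apply: nsa_resolvent_inj hA Ag Af _; rewrite addrC e.
Qed.

(** * Restriction of the inverse form to a subspace *)

Section Projection.
Variable L : set H.
Hypothesis cL : closed_subspace L.

Definition subspace_graph0 : set (H * H) := [set p | L p.1 /\ p.2 = 0].

Lemma subspace_graph0_closed : closed_subspace subspace_graph0.
Proof.
have [L0 LL clL] := cL; split.
- by split.
- move=> k u v [Lu u0] [Lv v0]; split; first exact: LL.
  by rewrite /= u0 v0 scaler0 addr0.
(* The condition p.2 = 0 describes the adjoint of the zero operator on H, hence a closed set. *)
- rewrite (_ : subspace_graph0 = fst @^-1` L `&` adjoint dot [set p | p.2 = 0]); last first.
    apply/seteqP; split => -[x y] [/= Lx].
      by move=> -> ; split => // f /= ->; rewrite linear0l linear0r.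
    move=> /adjoint_rdot/(_ (y, 0)) /= h; split => //=.
    by apply: sqn_eq0; rewrite /sqn -h // rdot0l.
  apply: closedI.
    by apply: closed_comp => // p _; exact: cvg_fst.
  have [] // := @adjoint_closed_subspace [set p | p.2 = 0].
  by move=> a f /= ->; rewrite scaler0.
Qed.

(** The product of [L] and its orthogonal complement, the relation of the form 0 on [L]. As a Gram
    relation it is selfadjoint at once, and its resolvent is the projection onto [L]. *)
Definition projection_relation := gram subspace_graph0.

Lemma projection_relationP x y :
  projection_relation (x, y) <-> L x /\ orthogonal_complement dot L y.
Proof.
split.
  move=> [z [/= Lx z0] hz]; split => // k Lk.
  have := hz (k, 0); rewrite /= linear0l => h.
  rewrite [LHS](hermC dot) /= -h ?rmorph0 ?mulr0 //.
move=> [Lx hy]; apply: (@gram_intro _ _ 0); first exact: subspace_graph0_closed.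
  by split.
move=> [k z] [/= Lk ->]; rewrite rdot0l rdotC /rdot.
by rewrite (hy k Lk).
Qed.

Lemma orthogonal_projectionP x y :
  orthogonal_projection dot L x = y <-> projection_relation (y, x - y).
Proof.
have hP : nonneg_selfadjoint dot projection_relation.
  by apply: nsa_gram; exact: subspace_graph0_closed.
have uniq u v : projection_relation (u, x - u) -> projection_relation (v, x - v) -> u = v.
  move=> hu hv; have := nsa_resolvent_inj hP hu hv; rewrite /= addrC subrK addrC subrK.
  by move=> /(_ erefl)[].
have hx : projection_relation (orthogonal_projection dot L x, x - orthogonal_projection dot L x).
  apply/projection_relationP.
  apply: (@getPex _ [set y | L y /\ orthogonal_complement dot L (x - y)]).
  have [[u v] hu /= <-] := nsa_resolvent hP ltr01 x; exists u.
  by apply/projection_relationP; rewrite scale1r addrC addKr.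
by split => [<- //|]; exact: uniq.
Qed.

(** y = t P x holds exactly when y is in [L] and x - y / t is orthogonal to [L]. *)
Lemma inv_scaled_projection (t : R) : 0 < t ->
  ((scaled_projection dot t L)^-1)%relation = shift t^-1 projection_relation.
Proof.
move=> t0; have [L0 LL _] := cL.
have tne : t%:C%C != 0 :> R[i] by rewrite fmorph_eq0 gt_eqF.
have e1 (y : H) : t%:C%C *: ((t^-1)%:C%C *: y) = y.
  by rewrite scalerA -rmorphM divff ?gt_eqF // rmorph1 scale1r.
apply/seteqP; split => -[y x]; rewrite /shift /scaled_projection /=.
  move=> ->; set p := orthogonal_projection dot L x.
  have /orthogonal_projectionP/projection_relationP[Lp hp] : orthogonal_projection dot L x = p by [].
  apply/projection_relationP; split; first exact: subspaceZ.
  by rewrite scalerA mulrC -rmorphM divff ?gt_eqF // rmorph1 scale1r.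
move=> /projection_relationP[Ly hy].
have -> : orthogonal_projection dot L x = (t^-1)%:C%C *: y.
  by apply/orthogonal_projectionP/projection_relationP; split => //; exact: subspaceZ.
by rewrite e1.
Qed.

Lemma epi_projection_relation x c : epi projection_relation x c <-> L x /\ 0 <= c.
Proof.
rewrite epi_gram; last exact: subspace_graph0_closed.
split; first by move=> [z [/= Lx ->]]; rewrite sqn0.
by move=> [Lx c0]; exists 0; rewrite ?sqn0.
Qed.

(** * The shorted relation and the parallel sums *)

Variable A : set (H * H).
Hypothesis hA : nonneg_selfadjoint dot A.

(** The form is restricted through its root: cut down to [L], the root stays closed, so its Gram
    relation is selfadjoint and carries the restricted form. *)
Definition restricted_inv : set (H * H) :=
  gram (form_root dot (A^-1)%relation `&` fst @^-1` L).

Lemma restricted_root_closed :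
  closed_subspace (form_root dot (A^-1)%relation `&` fst @^-1` L).
Proof.
have [S0 SL clS] := form_root_subspace (nsa_inv hA); have [L0 LL clL] := cL; split.
- by split.
- by move=> k u v [Su Lu] [Sv Lv]; split; [exact: SL|exact: LL].
- by apply: closedI => //; apply: closed_comp => // p _; exact: cvg_fst.
Qed.

Lemma nsa_restricted_inv : nonneg_selfadjoint dot restricted_inv.
Proof. by apply: nsa_gram; exact: restricted_root_closed. Qed.

Lemma epi_restricted_inv x c :
  epi restricted_inv x c <-> L x /\ epi (A^-1)%relation x c.
Proof.
rewrite epi_gram; last exact: restricted_root_closed.
rewrite -{2}(gram_form_root (nsa_inv hA)) epi_gram; last exact: form_root_subspace (nsa_inv hA).
split; first by move=> [z [Sz Lx] zc]; split => //; exists z.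
by move=> [Lx [z Sz zc]]; exists z.
Qed.

Lemma parallel_sum_projection (t : R) : 0 < t ->
  parallel_sum dot A (scaled_projection dot t L) = ((shift t^-1 restricted_inv)^-1)%relation.
Proof.
move=> t0; have t1 : 0 <= t^-1 by rewrite invr_ge0 ltW.
have hP : nonneg_selfadjoint dot projection_relation.
  by apply: nsa_gram; exact: subspace_graph0_closed.
rewrite /parallel_sum inv_scaled_projection // (@form_sumE _ _ (shift t^-1 restricted_inv)) //.
- exact: nsa_inv.
- exact: nsa_shift.
- by apply: nsa_shift => //; exact: nsa_restricted_inv.
move=> x c; rewrite epi_shift //; last exact: nsa_restricted_inv.
rewrite epi_restricted_inv; split.
  (* The form of the inverse of t P is exactly |x|^2 / t on [L]; the rest of [c] goes to the inverse
     of [A]. *)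
  move=> [Lx hx]; exists (c - t^-1 * sqn x), (t^-1 * sqn x); split => //; last by rewrite subrK.
  by apply/epi_shift => //; apply/epi_projection_relation; rewrite subrr.
move=> [a [b [ha /epi_shift-/(_ t1 hP)/epi_projection_relation[Lx hb] abc]]]; split => //.
by move=> f Af; have := ha f Af; lra.
Qed.

Lemma shorted_maximal :
  minorants_with_range dot A L (restricted_inv^-1)%relation /\
  forall T, minorants_with_range dot A L T -> relation_le dot T (restricted_inv^-1)%relation.
Proof.
have hT := nsa_restricted_inv; have hi := nsa_inv hA; split; [split|].
- exact: nsa_inv.
- apply/relation_leP => //; first exact: nsa_inv.
  rewrite -{1}(inv_invE A); apply: epi_inv_anti => // x c.
  by move=> /epi_restricted_inv[].
- by move=> x [y [z [_ Lx] _]].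
move=> T [hTT /relation_leP-/(_ hTT hA) TA TL]; apply/relation_leP => //; first exact: nsa_inv.
rewrite -(inv_invE T); apply: epi_inv_anti => //; first exact: nsa_inv.
move=> x c hx; apply/epi_restricted_inv; split; last exact: (epi_inv_anti hTT hA).
(* A form-domain point of the inverse of [T] is a limit of points of its domain, which is the range
   of [T] and lies in the closed set [L]. *)
have [f [Tf _ _ fx]] := epi_approx_seq (nsa_inv hTT) hx.
have [_ _ clL] := cL; apply: (closed_seq1 clL _ fx) => n; apply: TL.
by exists (f n).2; exact: Tf.
Qed.

Lemma shortedE : shorted dot A L = (restricted_inv^-1)%relation.
Proof.
have [m mx] := shorted_maximal; have hT := nsa_inv nsa_restricted_inv.
have [m2 mx2] : minorants_with_range dot A L (shorted dot A L) /\
    forall T, minorants_with_range dot A L T -> relation_le dot T (shorted dot A L).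
  pose P := [set B | minorants_with_range dot A L B /\
    forall T, minorants_with_range dot A L T -> relation_le dot T B].
  exact: (getPex (ex_intro P _ shorted_maximal)).
have [hS _ _] := m2.
have /relation_leP-/(_ hS hT) h1 := mx _ m2.
have /relation_leP-/(_ hT hS) h2 := mx2 _ m.
by apply: epi_inj => // x c; split; [exact: h2|exact: h1].
Qed.

(** * Convergence of the resolvents *)

Lemma resolvent_distance (t : R) h : 0 < t ->
  sqn (resolvent (parallel_sum dot A (scaled_projection dot t L)) h -
       resolvent (shorted dot A L) h) <= t^-1 ^+ 2 * sqn h.
Proof.
move=> t0; have : 0 <= t^-1 by rewrite invr_ge0 ltW.
(* From here on [t] stands for the inverse of the original parameter. *)
rewrite shortedE parallel_sum_projection //; move: t^-1 => {t0}t t0.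
have hT := nsa_inv nsa_restricted_inv.
have hTt := nsa_inv (nsa_shift t0 nsa_restricted_inv).
have [[u v] Tu /=] := nsa_resolvent hT ltr01 h; rewrite scale1r => uv.
have [[a b] Ta /=] := nsa_resolvent hTt ltr01 h; rewrite scale1r => ab.
have /= := resolventE hT Tu; rewrite uv => ->.
have /= := resolventE hTt Ta; rewrite ab => ->.
have := nsa_ge0 hTt Ta; rewrite /= => ba.
(* Undoing the shift gives a pair of the limit relation, comparable with (u, v); with d = a - u,
   monotonicity reads |d|^2 <= t (d, b). *)
have Ta' : (restricted_inv^-1)%relation (a - t%:C%C *: b, b) by [].
have := nsa_ge0 hT (subspaceB (nsa_subspace hT) Ta' Tu); rewrite /=.
have -> : b - v = - (a - u) by apply: sum_eq_sub; rewrite ab.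
rewrite [a - _ - u]addrAC; move: (a - u) => d h1.
have h2 : sqn b <= sqn h.
  by rewrite -ab sqnD (rdotC a b); have := sqn_ge0 a; lra.
have h3 : t ^+ 2 * sqn b <= t ^+ 2 * sqn h by rewrite ler_wpM2l ?sqr_ge0.
apply: le_trans h3; have := sqn_ge0 (d - t%:C%C *: b).
by move: h1; rewrite sqnB sqnZ !rdotE -/(sqn d); lra.
Qed.

End Projection.

End HilbertSpace.

Theorem theorem4p3 (R : realType) (H : completeNormedModType R[i])
    (dot : {dot H for @Num.conj R[i]})
    (norm_dot : forall x : H, `|x| ^+ 2 = dot x x)
    (A : set (H * H)) (hA : nonneg_selfadjoint dot A)
    (L : set H) (hL : closed_subspace L) :
  strong_resolvent_limit
    (fun t : R => parallel_sum dot A (scaled_projection dot t L)) +oo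
    (shorted dot A L).
Proof.
move=> h; apply/(cvg_sqn norm_dot)/cvgr0Pnorm_lt => e e0.
near=> t.
(* For t >= 1 the bound |h|^2 / t^2 is at most |h|^2 / t, which the next condition puts below
   [e]. *)
have t1 : 1 <= t by near: t; apply: nbhs_pinfty_ge; exact: num_real.
have te : sqn dot h / e < t by near: t; apply: nbhs_pinfty_gt; exact: num_real.
have t0 : 0 < t by lra.
rewrite ger0_norm ?sqn_ge0 //.
apply: le_lt_trans (resolvent_distance norm_dot hL hA h t0) _.
have ti : t^-1 <= 1 by rewrite invf_le1.
have ti0 : 0 < t^-1 by rewrite invr_gt0.
apply: (@le_lt_trans _ _ (t^-1 * sqn dot h)).
  by rewrite expr2 -mulrA ler_piMl // mulr_ge0 ?sqn_ge0 // ltW.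
by rewrite mulrC ltr_pdivrMr // mulrC -ltr_pdivrMr.
Unshelve. all: end_near. Qed.
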